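(* Let $0<q<1$, $k>0$, $s,t>-1$ and $v\in\mathbb{C}$ with $|\mathrm{Re}(v)+1|<2+s+t$. Then for all $y,y'\in\mathbb{Z}_{\ge0}$, $$\sum_{x=0}^\infty P_{\mathrm r}(x,y;s,t,v,k)\,\overline{P_{\mathrm r}(x,y';s,t,-\overline v-2,k)}\,W_k(x,s;q)=\frac{\delta_{y,y'}}{W_k(y,t;q)},$$ and for all $x,x'\in\mathbb{Z}_{\ge0}$, $$\sum_{y=0}^\infty P_{\mathrm r}(x,y;s,t,v,k)\,\overline{P_{\mathrm r}(x',y;s,t,-\overline v-2,k)}\,W_k(y,t;q)=\frac{\delta_{x,x'}}{W_k(x,s;q)}.$$
   Context: $q^z=e^{z\log q}$; $(\alpha;p)_n=\prod_{i=0}^{n-1}(1-\alpha p^i)$, $(\alpha_1,\dots,\alpha_m;p)_n=\prod_i(\alpha_i;p)_n$, $(\alpha;p)_\infty=\lim_{n\to\infty}(\alpha;p)_n$ for $0<p<1$. For $n,x\in\mathbb{Z}_{\ge0}$, $$\phi_{u,s}(n,x)=q^{n(s-u+\frac12k+\frac12)}\sum_{j=0}^{\min(n,x)}\frac{(q^{2n},\,q^{2x},\,q^{-2x-2s-2k};q^{-2})_j}{(q^{-2k},\,q^{-2};q^{-2})_j}q^{-2j},\qquad w_k(n)=q^{-n(k-1)}\frac{(q^{2k};q^2)_n}{(q^2;q^2)_n}.$$ For $\mathrm{Re}(v)<1+s+t$ the function $P_{\mathrm r}$ is the absolutely convergent sum $$P_{\mathrm r}(x,y;s,t,v,k)=\sum_{n=0}^\infty\phi_{1,s}(n,x)\,\phi_{v,t}(n,y)\,w_k(n)$$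 (the condition $|\mathrm{Re}(v)+1|<2+s+t$ says that this holds for both $v$ and $-\overline v-2$). Weight: $$W_k(x,s;q)=\frac{1-q^{4x+2s+2k}}{1-q^{2x+2s+2k}}\,\frac{(q^{2k};q^2)_x}{(q^2;q^2)_x}\,\frac{(q^{2x+2s+2};q^2)_\infty}{(q^{2x+2s+2k+2};q^2)_\infty}\,q^{2x(x+s)},$$ where for $x=0$ the first fraction is read as $1$. *)

(* Defs.v *)
From Stdlib Require Import Reals List.
From Coquelicot Require Import Coquelicot.
Import ListNotations.
Open Scope R_scope.

Definition Cexp (z : C) : C :=
  (exp (Re z) * cos (Im z), exp (Re z) * sin (Im z)).

(* [q ^ z] for a base [q > 0] and a complex exponent; for real exponents
   [Rpower q x = exp (x * ln q)] is used. *)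
Definition Cqpow (q : R) (z : C) : C := Cexp (z * RtoC (ln q))%C.

(* [(a; p)_n] *)
Fixpoint qpoch (a p : R) (n : nat) : R :=
  match n with
  | O => 1
  | S m => qpoch a p m * (1 - a * p ^ m)
  end.

(* [(a_1, ..., a_m; p)_n] *)
Definition qpochs (l : list R) (p : R) (n : nat) : R :=
  fold_right (fun a r => qpoch a p n * r) 1 l.

(* [(a; p)_oo]; the limit exists for [0 < p < 1]. *)
Definition qpoch_inf (a p : R) : R := real (Lim_seq (qpoch a p)).

(* Sum of a convergent complex series, taken componentwise as Coquelicot's
   [Series] is real-valued. *)
Definition CSeries (a : nat -> C) : C :=
  (Series (fun n => Re (a n)), Series (fun n => Im (a n))).

(* [sum_n f m] is the sum of [f 0, ..., f m], with [m + 1] terms. *)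
Definition phi_sum (q k s : R) (n x : nat) : R :=
  sum_n (fun j : nat =>
    qpochs [Rpower q (2 * INR n); Rpower q (2 * INR x);
            Rpower q (- 2 * INR x - 2 * s - 2 * k)] (Rpower q (- 2)) j
    / qpochs [Rpower q (- 2 * k); Rpower q (- 2)] (Rpower q (- 2)) j
    * Rpower q (- 2 * INR j)) (Nat.min n x).

Definition phi (q k : R) (u : C) (s : R) (n x : nat) : C :=
  (Cqpow q (RtoC (INR n) * (RtoC s - u + RtoC (k / 2)%R + RtoC (1 / 2)%R))
   * RtoC (phi_sum q k s n x))%C.

Definition w (q k : R) (n : nat) : R :=
  Rpower q (- INR n * (k - 1))
  * (qpoch (Rpower q (2 * k)) (Rpower q 2) n
     / qpoch (Rpower q 2) (Rpower q 2) n).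

(* The series converges absolutely when [Re v < 1 + s + t]. *)
Definition P_r (q k : R) (x y : nat) (s t : R) (v : C) : C :=
  CSeries (fun n => (phi q k (RtoC 1) s n x * phi q k v t n y * RtoC (w q k n))%C).

(* At [x = 0] the quotient is formally 1 but may be 0/0, as [s + k = 0] is
   possible. *)
Definition W_ratio (q k : R) (x : nat) (s : R) : R :=
  match x with
  | O => 1
  | S _ => (1 - Rpower q (4 * INR x + 2 * s + 2 * k))
           / (1 - Rpower q (2 * INR x + 2 * s + 2 * k))
  end.

Definition W (q k : R) (x : nat) (s : R) : R :=
  W_ratio q k x s
  * (qpoch (Rpower q (2 * k)) (Rpower q 2) x
     / qpoch (Rpower q 2) (Rpower q 2) x)
  * (qpoch_inf (Rpower q (2 * INR x + 2 * s + 2)) (Rpower q 2)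
     / qpoch_inf (Rpower q (2 * INR x + 2 * s + 2 * k + 2)) (Rpower q 2))
  * Rpower q (2 * INR x * (INR x + s)).

Definition delta (m n : nat) : R := if Nat.eqb m n then 1 else 0.

(* Main.v *)
Require Import Defs.
From Stdlib Require Import Reals Lra Lia List.
From Coquelicot Require Import Coquelicot.
Open Scope R_scope.

(** Put [p = q^2], [b = p^k], [A = p^(s+1)], [B = p^(t+1)] and
    [h_n = (b;p)_n/(p;p)_n].  Then [phi_sum] is a polynomial [psi] of degree [x]
    in [p^n] and [P_r] is the sum of [z^n h_n psi_A(x) psi_B(y)] over [n], with
    [z = q^(s+t-v+1)]; the conjugated factor has [z' = q^(s+t+v+3)] instead, so
    [z z' = A B].  The q-binomial theorem and q-Vandermonde give the generating
    function of [h_n psi_A(x)] as [gser z * Rfac x z], where [gser z] stands for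
    [(zb;p)_oo/(z;p)_oo].  Summing a product of two such generating functions
    over [x] against the weight is the nonterminating 6phi5 sum, with value
    [gser (z z'/A)].  It is proved from a first-order recurrence in [z]
    (telescoping in [x]), iterated down to [z = 0] and normalized at [z = A],
    where only the term [x = 0] survives; this covers the whole convergence
    region [|z z'| < A], beyond the reach of a Parseval argument.  Expanding
    [psi_B] in powers of [p^n] reduces the claim to the orthogonality of the
    little q-Jacobi polynomials [psi_B], which follows from the zeros [B p^m],
    [m < y], of [Rfac y].  The second identity is the first one, as [P_r] is
    symmetric under exchanging [(x,s)] and [(y,t)]. *)

(** * Complex series *)

(** The sum over [x] is never interchanged with the sums over [n] that define [P_r]. Multiplying a
    coefficient by [p^(n m)] only replaces [z] by [z p^m], so a value of [P_r] is a finite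
    combination of the closed forms [gser (z p^m) * Rfac x (z p^m)], and the sum over [x] is a
    finite double combination of 6phi5 sums. Their values [gser (B p^(m+m'))] no longer contain [z]
    and [z'], which is why [v] is absent from the right-hand sides. They are the moments of order
    [m + m'] of the measure with mass [B^n h_n] at [p^n], the little q-Jacobi measure, so an inner
    product of two polynomials [psi_B] remains. The assumptions enter as [b], [A], [B] in [(0, 1)],
    and as [|z| < 1] and [|z'| < 1], one from each side of the bound on [Re v]. Then
    [|z z'| = A B < A] holds automatically. *)

Lemma is_series_C_ext (a b : nat -> C) (l : C) :
  (forall n, a n = b n) -> is_series a l -> is_series b l.
Proof. intros E H. now apply (is_series_ext a). Qed.

Lemma is_series_C_unique (a : nat -> C) (l1 l2 : C) :
  is_series a l1 -> is_series a l2 -> l1 = l2.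
Proof.
  intros H1 H2.
  exact (filterlim_locally_unique (F := eventually) _ _ _ H1 H2).
Qed.

Lemma is_series_Cmult_l (c : C) (a : nat -> C) (l : C) :
  is_series a l -> is_series (fun n => c * a n)%C (c * l)%C.
Proof. exact (is_series_scal (V := C_NormedModule) c a l). Qed.

Lemma is_series_Cplus (a b : nat -> C) (la lb : C) :
  is_series a la -> is_series b lb ->
  is_series (fun n => a n + b n)%C (la + lb)%C.
Proof. exact (is_series_plus (V := C_NormedModule) a b la lb). Qed.

Lemma is_series_Cminus (a b : nat -> C) (la lb : C) :
  is_series a la -> is_series b lb ->
  is_series (fun n => a n - b n)%C (la - lb)%C.
Proof. exact (is_series_minus (V := C_NormedModule) a b la lb). Qed.

Lemma is_series_C_sum_n (f : nat -> nat -> C) (l : nat -> C) (N : nat) :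
  (forall m, is_series (f m) (l m)) ->
  is_series (fun n => sum_n (fun m => f m n) N) (sum_n l N).
Proof.
  intros H. induction N as [|N IH].
  - rewrite sum_O. apply (is_series_C_ext (f 0%nat)); [|apply H].
    intros n. now rewrite sum_O.
  - rewrite sum_Sn.
    apply (is_series_C_ext (fun n => sum_n (fun m => f m n) N + f (S N) n)%C).
    + intros n. now rewrite sum_Sn.
    + now apply is_series_Cplus.
Qed.

Lemma sum_n_Re (a : nat -> C) (N : nat) :
  Re (sum_n a N) = sum_n (fun n => Re (a n)) N.
Proof.
  induction N as [|N IH]; [now rewrite !sum_O|].
  rewrite !sum_Sn, <- IH. reflexivity.
Qed.

Lemma sum_n_Im (a : nat -> C) (N : nat) :
  Im (sum_n a N) = sum_n (fun n => Im (a n)) N.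
Proof.
  induction N as [|N IH]; [now rewrite !sum_O|].
  rewrite !sum_Sn, <- IH. reflexivity.
Qed.

Lemma is_series_Re (a : nat -> C) (l : C) :
  is_series a l -> is_series (fun n => Re (a n)) (Re l).
Proof.
  intros H. unfold is_series.
  apply (filterlim_ext (fun N => Re (sum_n a N))); [apply sum_n_Re|].
  refine (filterlim_comp _ _ _ (sum_n a) Re _ _ _ H _).
  destruct l as [x y].
  exact (continuous_fst (U := R_UniformSpace) (V := R_UniformSpace) x y).
Qed.

Lemma is_series_Im (a : nat -> C) (l : C) :
  is_series a l -> is_series (fun n => Im (a n)) (Im l).
Proof.
  intros H. unfold is_series.
  apply (filterlim_ext (fun N => Im (sum_n a N))); [apply sum_n_Im|].
  refine (filterlim_comp _ _ _ (sum_n a) Im _ _ _ H _).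
  destruct l as [x y].
  exact (continuous_snd (U := R_UniformSpace) (V := R_UniformSpace) x y).
Qed.

(** [Series] has a default value on divergent input; this lemma identifies [CSeries] with a genuine
    sum once convergence is known. *)
Lemma CSeries_unique (a : nat -> C) (l : C) : is_series a l -> CSeries a = l.
Proof.
  intros H. unfold CSeries.
  rewrite (is_series_unique _ _ (is_series_Re _ _ H)).
  rewrite (is_series_unique _ _ (is_series_Im _ _ H)).
  now destruct l.
Qed.

Lemma CSeries_conj (a : nat -> C) :
  Cconj (CSeries a) = CSeries (fun n => Cconj (a n)).
Proof.
  unfold CSeries, Cconj; cbn. f_equal. now rewrite <- Series_opp.
Qed.

Lemma ex_series_C_le (a : nat -> C) (M : nat -> R) :
  (forall n, Cmod (a n) <= M n) -> ex_series M -> exists l : C, is_series a l.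
Proof. exact (ex_series_le (V := C_CompleteNormedModule) a M). Qed.

Lemma Cmod_sum_n_le (a : nat -> C) (M : nat -> R) (N : nat) :
  (forall n, Cmod (a n) <= M n) -> Cmod (sum_n a N) <= sum_n M N.
Proof.
  intros H. induction N as [|N IH]; [rewrite !sum_O; apply H|].
  rewrite !sum_Sn. eapply Rle_trans; [apply Cmod_triangle|].
  apply Rplus_le_compat; auto.
Qed.

Lemma filterlim_Cmod (u : nat -> C) (l : C) :
  filterlim u eventually (locally l) -> is_lim_seq (fun n => Cmod (u n)) (Cmod l).
Proof.
  intros H.
  refine (filterlim_comp _ _ _ u Cmod _ _ _ H _).
  exact (filterlim_norm (V := C_NormedModule) l).
Qed.

Lemma Cmod_series_le (a : nat -> C) (M : nat -> R) (l : C) :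
  (forall n, Cmod (a n) <= M n) -> ex_series M -> is_series a l ->
  Cmod l <= Series M.
Proof.
  intros H HM Hl.
  assert (L := filterlim_Cmod _ _ Hl).
  assert (L2 : is_lim_seq (sum_n M) (Series M)) by exact (Series_correct M HM).
  refine (is_lim_seq_le _ _ _ _ _ L L2).
  intros n. now apply Cmod_sum_n_le.
Qed.

Lemma Cmod_series_tail_le (a : nat -> C) (M : nat -> R) (l : C) (N : nat) :
  (forall n, Cmod (a n) <= M n) -> ex_series M -> is_series a l ->
  Cmod (l - sum_n a N) <= Series M - sum_n M N.
Proof.
  intros H HM Hl.
  assert (T : is_series (fun k => a (S N + k)%nat) (l - sum_n a N)%C).
  { apply (is_series_incr_n (V := C_NormedModule)); [lia|].
    simpl pred.
    change (is_series a (l - sum_n a N + sum_n a N)%C).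
    now replace (l - sum_n a N + sum_n a N)%C with l by ring. }
  assert (E : Series M - sum_n M N = Series (fun k => M (S N + k)%nat)).
  { rewrite (Series_incr_n M (S N)); [|lia|exact HM]. simpl pred.
    rewrite sum_n_Reals. ring. }
  rewrite E.
  apply (Cmod_series_le _ _ _ (fun k => H (S N + k)%nat)); [|exact T].
  now apply (ex_series_incr_n M).
Qed.

Lemma C_filterlim_Cmod (u : nat -> C) (l : C) :
  is_lim_seq (fun n => Cmod (u n - l)) 0 -> filterlim u eventually (locally l).
Proof.
  intros H.
  apply (filterlim_locally_ball_norm (U := C_NormedModule) (F := eventually)).
  intros eps.
  apply is_lim_seq_spec in H. destruct (H eps) as [N HN].
  exists N. intros n Hn. specialize (HN n Hn).
  rewrite Rminus_0_r in HN. apply Rabs_lt_between in HN.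
  unfold ball_norm. exact (proj2 HN).
Qed.

Lemma C_Cmod_filterlim (u : nat -> C) (l : C) :
  filterlim u eventually (locally l) -> is_lim_seq (fun n => Cmod (u n - l)) 0.
Proof.
  intros H.
  assert (H2 : filterlim (fun n => (u n - l)%C) eventually (locally (l - l)%C)).
  { refine (filterlim_comp_2 u (fun _ => opp l) plus H (filterlim_const (opp l)) _).
    exact (filterlim_plus (V := C_NormedModule) l (opp l)). }
  apply filterlim_Cmod in H2. replace (l - l)%C with (RtoC 0) in H2 by ring.
  now rewrite Cmod_0 in H2.
Qed.

(** Dominated convergence for series: the tails of [M] bound all tails uniformly in [m], so the
    partial sums converge uniformly and the limits in [N] and [m] may be switched. *)
Lemma tannery (f : nat -> nat -> C) (g : nat -> C) (M : nat -> R)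
    (L : nat -> C) (l : C) :
  (forall m x, Cmod (f m x) <= M x) -> ex_series M ->
  (forall x, filterlim (fun m => f m x) eventually (locally (g x))) ->
  (forall m, is_series (f m) (L m)) -> is_series g l ->
  filterlim L eventually (locally l).
Proof.
  intros HM Ms Hx HL Hl.
  assert (Sw := filterlim_switch (U := C_CompleteNormedModule)
    eventually _ eventually _
    (fun (N m : nat) => sum_n (f m) N) L (fun N => sum_n g N)).
  destruct Sw as [l' [H1 H2]].
  - apply filterlim_locally. intros eps.
    assert (MS : is_lim_seq (sum_n M) (Series M)) by exact (Series_correct M Ms).
    apply is_lim_seq_spec in MS.
    assert (Pe : 0 < eps / 2) by (destruct eps; simpl; lra).
    destruct (MS (mkposreal _ Pe)) as [N0 HN0].
    exists N0. intros N HN m.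
    apply (norm_compat1 (V := C_NormedModule)).
    change (Cmod (sum_n (f m) N - L m) < eps).
    specialize (HN0 N HN). simpl in HN0. apply Rabs_lt_between in HN0.
    assert (T := Cmod_series_tail_le _ _ _ N (HM m) Ms (HL m)).
    rewrite <- Cmod_opp.
    replace (- (sum_n (f m) N - L m))%C with (L m - sum_n (f m) N)%C by ring.
    destruct eps; simpl in *; lra.
  - intros N. induction N as [|N IH].
    + rewrite sum_O. apply (filterlim_ext (fun m => f m 0%nat)); [|apply Hx].
      intros m. now rewrite sum_O.
    + rewrite sum_Sn.
      apply (filterlim_ext (fun m => plus (sum_n (f m) N) (f m (S N)))).
      { intros m. now rewrite sum_Sn. }
      refine (filterlim_comp_2 _ _ plus IH (Hx (S N)) _).
      apply (filterlim_plus (V := C_NormedModule)).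
  - rewrite (is_series_C_unique g l l' Hl H1). exact H2.
Qed.

(** * Finite products and the q-Vandermonde sum *)

Lemma sum_n_C_S (f : nat -> C) (n : nat) :
  sum_n f (S n) = (sum_n f n + f (S n))%C.
Proof. now rewrite sum_Sn. Qed.

Lemma sum_n_C_shift (f : nat -> C) (n : nat) :
  sum_n f (S n) = (f 0%nat + sum_n (fun i => f (S i)) n)%C.
Proof.
  induction n as [|n IH].
  - now rewrite sum_n_C_S, !sum_O.
  - rewrite sum_n_C_S, IH, sum_n_C_S. symmetry. apply Cplus_assoc.
Qed.

Lemma sum_n_C_ext (f g : nat -> C) (n : nat) :
  (forall i, (i <= n)%nat -> f i = g i) -> sum_n f n = sum_n g n.
Proof. apply sum_n_ext_loc. Qed.

Lemma sum_n_C_mult (c : C) (f : nat -> C) (n : nat) :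
  sum_n (fun i => c * f i)%C n = (c * sum_n f n)%C.
Proof. exact (sum_n_mult_l (K := C_Ring) c f n). Qed.

Lemma sum_n_RtoC (f : nat -> R) (n : nat) :
  RtoC (sum_n f n) = sum_n (fun i => RtoC (f i)) n.
Proof.
  induction n as [|n IH]; [now rewrite !sum_O|].
  rewrite sum_n_C_S, sum_Sn, <- IH. apply RtoC_plus.
Qed.

Fixpoint Cprod (f : nat -> C) (n : nat) : C :=
  match n with
  | O => 1
  | S m => (Cprod f m * f m)%C
  end.

Lemma Cprod_ext (f g : nat -> C) (n : nat) :
  (forall i, (i < n)%nat -> f i = g i) -> Cprod f n = Cprod g n.
Proof.
  intros H. induction n as [|n IH]; [reflexivity|].
  simpl. rewrite IH; [now rewrite (H n) by lia|]. intros i Hi. apply H. lia.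
Qed.

Lemma Cprod_shift (f : nat -> C) (n : nat) :
  Cprod f (S n) = (f 0%nat * Cprod (fun i => f (S i)) n)%C.
Proof.
  induction n as [|n IH]; [simpl; ring|].
  change (Cprod f (S (S n))) with (Cprod f (S n) * f (S n))%C.
  rewrite IH. simpl. ring.
Qed.

Lemma Cprod_mult (f g : nat -> C) (n : nat) :
  Cprod (fun i => f i * g i)%C n = (Cprod f n * Cprod g n)%C.
Proof. induction n as [|n IH]; simpl; [ring|]. rewrite IH. ring. Qed.

Lemma Cprod_rev (f : nat -> C) (n : nat) :
  Cprod (fun i => f (n - S i)%nat) n = Cprod f n.
Proof.
  induction n as [|n IH]; [reflexivity|].
  rewrite Cprod_shift.
  rewrite (Cprod_ext (fun i => f (S n - S (S i))%nat) (fun i => f (n - S i)%nat)).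
  - rewrite IH. simpl. rewrite Nat.sub_0_r. ring.
  - intros i Hi. f_equal.
Qed.

Lemma Cprod_neq_0 (f : nat -> C) (n : nat) :
  (forall i, (i < n)%nat -> f i <> 0) -> Cprod f n <> 0.
Proof.
  intros H. induction n as [|n IH]; simpl.
  - apply C1_nz.
  - apply Cmult_neq_0; [apply IH; intros i Hi; apply H; lia|apply H; lia].
Qed.

Lemma Cprod_eq_0 (f : nat -> C) (n i : nat) :
  (i < n)%nat -> f i = 0 -> Cprod f n = 0.
Proof.
  intros Hi H. induction n as [|n IH]; [lia|]. simpl.
  destruct (Nat.eq_dec i n) as [->|E].
  - rewrite H. ring.
  - rewrite IH by lia. ring.
Qed.

Lemma Cprod_div (f g : nat -> C) (n : nat) :
  (forall i, (i < n)%nat -> g i <> 0) ->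
  Cprod (fun i => f i / g i)%C n = (Cprod f n / Cprod g n)%C.
Proof.
  intros H. induction n as [|n IH]; simpl; [field; apply C1_nz|].
  rewrite IH by (intros i Hi; apply H; lia).
  field. split; [apply H; lia|]. apply Cprod_neq_0. intros i Hi. apply H. lia.
Qed.

Lemma RtoC_qpoch (a p : R) (n : nat) :
  RtoC (qpoch a p n) = Cprod (fun i => 1 - a * p ^ i)%C n.
Proof.
  induction n as [|n IH]; [reflexivity|].
  simpl. rewrite <- IH, RtoC_mult, RtoC_minus, RtoC_mult, RtoC_pow. reflexivity.
Qed.

(* Increasing [x] by one changes the sum by a multiple of the same sum with
   [beta / p] and [Gam * p], so [x] can be treated by induction with [beta] and
   [Gam] general. *)
Lemma q_Vandermonde (p : C) (x : nat) (beta Gam : C) :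
  (forall n, p ^ n <> 0)%C -> (forall n, 1 - p ^ S n <> 0)%C ->
  (forall n, 1 - Gam * p ^ n <> 0)%C ->
  sum_n (fun j =>
    Cprod (fun i => 1 - p ^ x / p ^ i)%C j * Cprod (fun i => 1 - beta / p ^ i)%C j
    / Cprod (fun i => 1 - / p ^ S i)%C j / p ^ j
    * Cprod (fun i => - Gam * p ^ i / (1 - Gam * p ^ i))%C j)%C x
  = Cprod (fun i => (1 - beta * Gam * p ^ i) / (1 - Gam * p ^ i))%C x.
Proof.
  intros Hp Hp1. revert beta Gam.
  assert (Hp0 : p <> 0) by (intros E; apply (Hp 1%nat); simpl; rewrite E; ring).
  induction x as [|x IH]; intros beta Gam HG.
  { rewrite sum_O. simpl. field. }
  (* For [Gam <> 0] the last product is [1 / (1/Gam; 1/p)_j], so this is the q-Chu-Vandermonde 2phi1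
     in base [1/p], in a form that also makes sense at [Gam = 0]. *)
  set (t := fun (x : nat) (beta Gam : C) (j : nat) =>
    (Cprod (fun i => 1 - p ^ x / p ^ i)%C j * Cprod (fun i => 1 - beta / p ^ i)%C j
    / Cprod (fun i => 1 - / p ^ S i)%C j / p ^ j
    * Cprod (fun i => - Gam * p ^ i / (1 - Gam * p ^ i))%C j)%C).
  assert (IH' : forall beta Gam, (forall n, 1 - Gam * p ^ n <> 0)%C ->
    sum_n (t x beta Gam) x
    = Cprod (fun i => (1 - beta * Gam * p ^ i) / (1 - Gam * p ^ i))%C x)
    by exact IH.
  change (sum_n (t (S x) beta Gam) (S x)
    = Cprod (fun i => (1 - beta * Gam * p ^ i) / (1 - Gam * p ^ i))%C (S x)).
  (* The factor [i = x] is zero, so the sum for [x] extends to [j = S x] and can be compared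
     termwise with the sum for [S x]. *)
  assert (Hz : t x beta Gam (S x) = 0).
  { unfold t. rewrite (Cprod_eq_0 (fun i => 1 - p ^ x / p ^ i)%C (S x) x).
    - unfold Cdiv. ring.
    - lia.
    - field. apply Hp. }
  assert (HG1 : forall n, (1 - Gam * p * p ^ n <> 0)%C).
  { intros n. specialize (HG (S n)). simpl in HG.
    now replace (Gam * p * p ^ n)%C with (Gam * (p * p ^ n))%C by ring. }
  assert (HG0 : (1 - Gam <> 0)%C).
  { specialize (HG 0%nat). simpl in HG. now rewrite Cmult_1_r in HG. }
  (* The products of [1 - p^(x+1)/p^i] and of [1 - p^x/p^i] share [j] of their [j + 1] factors. The
     remaining two differ by [p^x (1 - p^(j+1)) / p^j], which cancels the last denominator factor up
     to sign and a power of [p]. *)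
  assert (D : forall j, (t (S x) beta Gam (S j) - t x beta Gam (S j)
     = p ^ x * (1 - beta) * Gam / (1 - Gam) * t x (beta / p) (Gam * p) j)%C).
  { intros j. unfold t.
    rewrite (Cprod_shift (fun i => 1 - p ^ S x / p ^ i)%C).
    rewrite (Cprod_shift (fun i => 1 - beta / p ^ i)%C).
    rewrite (Cprod_shift (fun i => - Gam * p ^ i / (1 - Gam * p ^ i))%C).
    cbn [Cprod].
    rewrite (Cprod_ext (fun i => 1 - p ^ S x / p ^ S i)%C
                       (fun i => 1 - p ^ x / p ^ i)%C).
    2:{ intros i _. simpl. field. split; auto. }
    rewrite (Cprod_ext (fun i => 1 - beta / p ^ S i)%C
                       (fun i => 1 - beta / p / p ^ i)%C).
    2:{ intros i _. simpl. field. split; auto. }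
    rewrite (Cprod_ext (fun i => - Gam * p ^ S i / (1 - Gam * p ^ S i))%C
                       (fun i => - (Gam * p) * p ^ i / (1 - Gam * p * p ^ i))%C).
    2:{ intros i _. simpl. replace (Gam * (p * p ^ i))%C with (Gam * p * p ^ i)%C by ring.
        field. apply HG1. }
    assert (HD : Cprod (fun i => 1 - / p ^ S i)%C j <> 0).
    { apply Cprod_neq_0. intros i _ E. apply (Hp1 i).
      replace (1 - p ^ S i)%C with (- p ^ S i * (1 - / p ^ S i))%C.
      - rewrite E. ring.
      - field. apply Hp. }
    assert (HDj := Hp1 j). assert (Hpj := Hp j).
    generalize dependent (Cprod (fun i => 1 - / p ^ S i)%C j).
    generalize (Cprod (fun i => 1 - p ^ x / p ^ i)%C j).
    generalize (Cprod (fun i => 1 - beta / p / p ^ i)%C j).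
    generalize (Cprod (fun i => - (Gam * p) * p ^ i / (1 - Gam * p * p ^ i))%C j).
    intros a1 a2 a3 a4 Ha4. simpl in *.
    field. repeat split; auto.
    intros E. apply HDj. replace (1 - p * p ^ j)%C with (- (p * p ^ j - 1))%C by ring.
    rewrite E. ring. }
  rewrite sum_n_C_shift.
  assert (E : sum_n (fun j => t (S x) beta Gam (S j)) x =
    (sum_n (fun j => t x beta Gam (S j)) x
     + p ^ x * (1 - beta) * Gam / (1 - Gam) * sum_n (t x (beta / p) (Gam * p)) x)%C).
  { rewrite <- sum_n_C_mult.
    rewrite <- (sum_n_plus (G := C_AbelianMonoid)).
    apply sum_n_C_ext. intros j _. rewrite <- D.
    change (t (S x) beta Gam (S j) =
      (t x beta Gam (S j) + (t (S x) beta Gam (S j) - t x beta Gam (S j)))%C).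
    ring. }
  rewrite E.
  replace (t (S x) beta Gam 0%nat) with (t x beta Gam 0%nat) by reflexivity.
  rewrite Cplus_assoc, <- sum_n_C_shift, sum_n_C_S, Hz.
  rewrite (IH' beta Gam HG), (IH' (beta / p)%C (Gam * p)%C HG1).
  rewrite (Cprod_ext (fun i => (1 - beta / p * (Gam * p) * p ^ i) / (1 - Gam * p * p ^ i))%C
                     (fun i => (1 - beta * Gam * p ^ i) / (1 - Gam * p ^ S i))%C).
  2:{ intros i _. simpl. field. split; [|exact Hp0].
      replace (Gam * (p * p ^ i))%C with (Gam * p * p ^ i)%C by ring. apply HG1. }
  rewrite !Cprod_div by (intros; apply HG).
  assert (S1 := Cprod_shift (fun i => 1 - Gam * p ^ i)%C x). cbn [Cprod] in S1.
  assert (N1 : Cprod (fun i => 1 - Gam * p ^ i)%C x <> 0)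
    by (apply Cprod_neq_0; intros; apply HG).
  assert (N2 : Cprod (fun i => 1 - Gam * p ^ S i)%C x <> 0)
    by (apply Cprod_neq_0; intros; apply HG).
  assert (HGx := HG x).
  replace (Gam * p ^ 0)%C with Gam in S1 by (simpl; ring). cbn [Cprod].
  match goal with |- @eq _ ?u ?v => change (@eq C u v) end.
  revert S1 N1 N2.
  generalize (Cprod (fun i => 1 - Gam * p ^ i)%C x),
    (Cprod (fun i => 1 - Gam * p ^ S i)%C x),
    (Cprod (fun i => 1 - beta * Gam * p ^ i)%C x).
  intros d d' u S1 N1 N2.
  replace d with ((1 - Gam) * d' / (1 - Gam * p ^ x))%C
    by (rewrite <- S1; field; auto).
  field. repeat split; auto.
Qed.

(** * q-Pochhammer symbols and power series *)

Lemma Rpow_lt_1 (p : R) (n : nat) : 0 < p < 1 -> 0 < p ^ S n < 1.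
Proof.
  intros Hp. split; [now apply pow_lt|].
  induction n as [|n IH]; simpl in *; [lra|]. nra.
Qed.

Lemma Rpow_le_1 (p : R) (n : nat) : 0 < p < 1 -> 0 < p ^ n <= 1.
Proof.
  intros Hp. destruct n as [|n]; [simpl; lra|].
  assert (H := Rpow_lt_1 p n Hp). lra.
Qed.

Lemma qpoch_factor_pos (a p : R) (n : nat) :
  0 < p < 1 -> 0 <= a < 1 -> 0 < 1 - a * p ^ n <= 1.
Proof. intros Hp Ha. assert (H := Rpow_le_1 p n Hp). nra. Qed.

Lemma qpoch_bounds (a p : R) (n : nat) :
  0 < p < 1 -> 0 <= a < 1 -> 0 < qpoch a p n <= 1.
Proof.
  intros Hp Ha. induction n as [|n IH]; simpl; [lra|].
  assert (H := qpoch_factor_pos a p n Hp Ha). nra.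
Qed.

Lemma qpoch_add (a p : R) (m n : nat) :
  qpoch a p (m + n) = qpoch a p m * qpoch (a * p ^ m) p n.
Proof.
  induction n as [|n IH]; [rewrite Nat.add_0_r; simpl; ring|].
  rewrite Nat.add_succ_r. simpl. rewrite IH, pow_add. ring.
Qed.

Lemma qpoch_shift (a p : R) (n : nat) :
  qpoch a p (S n) = (1 - a) * qpoch (a * p) p n.
Proof. change (S n) with (1 + n)%nat. rewrite qpoch_add. simpl. rewrite !Rmult_1_r. ring. Qed.

(** The Weierstrass inequality: a product of factors [1 - u_i] is at least 1 minus the sum of the
    [u_i], here the geometric sum of [a p^i]. *)
Lemma qpoch_lower_small (a p : R) (n : nat) :
  0 < p < 1 -> 0 <= a < 1 -> 1 - a * (1 - p ^ n) / (1 - p) <= qpoch a p n.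
Proof.
  intros Hp Ha. induction n as [|n IH]; [simpl; right; field; lra|].
  simpl. assert (H := qpoch_factor_pos a p n Hp Ha).
  assert (Q := qpoch_bounds a p n Hp Ha).
  assert (P := Rpow_le_1 p n Hp).
  replace (a * (1 - p * p ^ n) / (1 - p))
    with (a * (1 - p ^ n) / (1 - p) + a * p ^ n) by (field; lra).
  nra.
Qed.

(** The Weierstrass bound is useful only for small [a]; splitting off the first [m] factors replaces
    [a] by [a p^m]. *)
Lemma qpoch_lower (a p : R) :
  0 < p < 1 -> 0 <= a < 1 -> exists L, 0 < L /\ forall n, L <= qpoch a p n.
Proof.
  intros Hp Ha.
  (* With [p^m < (1 - p)/2] the factors from index [m] on have product at least [1/2]. *)
  destruct (pow_lt_1_zero p ltac:(rewrite Rabs_pos_eq; lra) ((1 - p) / 2)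
              ltac:(lra)) as [m Hm].
  specialize (Hm m (Nat.le_refl m)).
  assert (Pm := Rpow_le_1 p m Hp).
  rewrite Rabs_pos_eq in Hm by lra.
  assert (Qm := qpoch_bounds a p m Hp Ha).
  exists (qpoch a p m * / 2). split; [lra|]. intros n.
  assert (Ham : 0 <= a * p ^ m < 1) by nra.
  apply Rle_trans with (qpoch a p (m + n)).
  - rewrite qpoch_add. apply Rmult_le_compat_l; [lra|].
    eapply Rle_trans; [|apply (qpoch_lower_small _ p n Hp Ham)].
    assert (Pn := Rpow_le_1 p n Hp).
    assert (E : a * p ^ m * (1 - p ^ n) / (1 - p) <= / 2); [|lra].
    apply Rmult_le_reg_r with (1 - p); [lra|].
    unfold Rdiv. rewrite Rmult_assoc, Rinv_l by lra. nra.
  - rewrite Nat.add_comm, qpoch_add.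
    assert (Qn := qpoch_bounds a p n Hp Ha).
    assert (Pn := Rpow_le_1 p n Hp).
    assert (B := qpoch_bounds (a * p ^ n) p m Hp ltac:(nra)). nra.
Qed.

(** Each factor satisfies [1 + c p^i <= exp (c p^i)], and the exponents add up to at most
    [c / (1 - p)]. *)
Lemma qpoch_upper (c p : R) :
  0 < p < 1 -> 0 <= c -> exists L, 0 < L /\ forall n, 0 < qpoch (- c) p n <= L.
Proof.
  intros Hp Hc. exists (exp (c / (1 - p))). split; [apply exp_pos|]. intros n.
  assert (H : 0 < qpoch (- c) p n <= exp (c * (1 - p ^ n) / (1 - p))).
  { induction n as [|n IH].
    - simpl. replace (c * (1 - 1) / (1 - p)) with 0 by (field; lra).
      rewrite exp_0. lra.
    - simpl. assert (P := Rpow_le_1 p n Hp).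
      replace (c * (1 - p * p ^ n) / (1 - p))
        with (c * (1 - p ^ n) / (1 - p) + c * p ^ n) by (field; lra).
      rewrite exp_plus. assert (E := exp_ineq1_le (c * p ^ n)).
      split; [apply Rmult_lt_0_compat; nra|].
      apply Rmult_le_compat; nra. }
  split; [apply H|]. eapply Rle_trans; [apply H|].
  assert (P := Rpow_le_1 p n Hp).
  assert (E : c * (1 - p ^ n) / (1 - p) <= c / (1 - p)).
  { apply Rmult_le_compat_r; [left; apply Rinv_0_lt_compat; lra|nra]. }
  destruct E as [E|E]; [left; now apply exp_increasing|right; now rewrite E].
Qed.

(** The partial products decrease and stay above a positive constant, so [Lim_seq] is a true finite
    limit and it is nonzero. *)
Lemma qpoch_inf_correct (a p : R) :
  0 < p < 1 -> 0 <= a < 1 ->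
  is_lim_seq (qpoch a p) (qpoch_inf a p) /\ 0 < qpoch_inf a p.
Proof.
  intros Hp Ha.
  destruct (qpoch_lower a p Hp Ha) as [L [HL Hn]].
  assert (F : ex_finite_lim_seq (qpoch a p)).
  { apply ex_finite_lim_seq_decr with L; [|exact Hn].
    intros n. simpl. assert (H := qpoch_factor_pos a p n Hp Ha).
    assert (Q := qpoch_bounds a p n Hp Ha). nra. }
  assert (S := Lim_seq_correct' _ F). split; [exact S|].
  apply Rlt_le_trans with L; [exact HL|].
  refine (is_lim_seq_le (fun _ => L) _ L _ Hn _ S).
  apply is_lim_seq_const.
Qed.

Lemma qpoch_inf_shift (a p : R) :
  0 < p < 1 -> 0 <= a < 1 -> qpoch_inf a p = (1 - a) * qpoch_inf (a * p) p.
Proof.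
  intros Hp Ha.
  destruct (qpoch_inf_correct a p Hp Ha) as [H1 _].
  destruct (qpoch_inf_correct (a * p) p Hp ltac:(nra)) as [H2 _].
  apply is_lim_seq_incr_1 in H1.
  apply (is_lim_seq_scal_l _ (1 - a)) in H2.
  apply (is_lim_seq_ext _ (fun n => qpoch a p (S n))) in H2.
  2:{ intros n. symmetry. apply qpoch_shift. }
  apply is_lim_seq_unique in H1. apply is_lim_seq_unique in H2.
  rewrite H1 in H2. now injection H2.
Qed.

Lemma Cmod_pos_real (x : R) : 0 <= x -> Cmod x = x.
Proof. intros H. rewrite Cmod_R. now apply Rabs_pos_eq. Qed.

Lemma RtoC_neq_0 (x : R) : x <> 0 -> RtoC x <> 0.
Proof. intros H E. apply H. now apply RtoC_inj. Qed.

Lemma Cminus_1_neq_0 (z : C) : Cmod z < 1 -> (1 - z)%C <> 0.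
Proof.
  intros H E. assert (z = 1).
  { replace z with (1 - (1 - z))%C by ring. rewrite E. ring. }
  subst z. rewrite Cmod_1 in H. lra.
Qed.

Lemma Cmod_mult_real_lt (z : C) (r : R) :
  Cmod z < 1 -> 0 <= r <= 1 -> Cmod (z * r) < 1.
Proof.
  intros Hz Hr. rewrite Cmod_mult, Cmod_pos_real by lra.
  assert (H := Cmod_ge_0 z). nra.
Qed.

Lemma Cminus_1_mult_neq_0 (z : C) (r : R) :
  Cmod z < 1 -> 0 <= r <= 1 -> (1 - z * r)%C <> 0.
Proof. intros Hz Hr. now apply Cminus_1_neq_0, Cmod_mult_real_lt. Qed.

Lemma power_series_bounded (a : nat -> C) (K : R) (z : C) :
  (forall n, Cmod (a n) <= K) -> Cmod z < 1 ->
  exists l, is_series (fun n => z ^ n * a n)%C l.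
Proof.
  intros HK Hz. assert (Z := Cmod_ge_0 z).
  apply ex_series_C_le with (fun n => Cmod z ^ n * K).
  - intros n. rewrite Cmod_mult, Cmod_pow.
    apply Rmult_le_compat_l; [now apply pow_le|apply HK].
  - apply ex_series_scal_r, ex_series_geom. now rewrite Rabs_pos_eq.
Qed.

Lemma power_series_near_0 (a : nat -> C) (K : R) (z l : C) :
  (forall n, Cmod (a n) <= K) -> Cmod z < 1 ->
  is_series (fun n => z ^ n * a n)%C l ->
  Cmod (l - a 0%nat) <= Cmod z * (K / (1 - Cmod z)).
Proof.
  intros HK Hz Hl. assert (Z := Cmod_ge_0 z).
  assert (G : is_series (fun n => Cmod z ^ n) (/ (1 - Cmod z)))
    by (apply is_series_geom; now rewrite Rabs_pos_eq).
  assert (G' : is_series (fun n => Cmod z * K * Cmod z ^ n)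
                 (Cmod z * K * / (1 - Cmod z)))
    by exact (is_series_scal (V := R_NormedModule) _ _ _ G).
  replace (Cmod z * (K / (1 - Cmod z)))
    with (Series (fun n => Cmod z * K * Cmod z ^ n))
    by (rewrite (is_series_unique _ _ G'); unfold Rdiv; ring).
  apply Cmod_series_le with (fun n => z ^ S n * a (S n))%C.
  - intros n. rewrite Cmod_mult, Cmod_pow. simpl.
    replace (Cmod z * K * Cmod z ^ n) with (Cmod z * Cmod z ^ n * K) by ring.
    apply Rmult_le_compat_l; [|apply HK].
    apply Rmult_le_pos; [exact Z|now apply pow_le].
  - eexists; exact G'.
  - apply (is_series_incr_1 (V := C_NormedModule) (fun n => z ^ n * a n)%C).
    change (is_series (fun n => z ^ n * a n)%C (l - a 0%nat + 1 * a 0%nat)%C).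
    now replace (l - a 0%nat + 1 * a 0%nat)%C with l by ring.
Qed.

(** Continuity at 0 along the orbit [z p^m], the form in which iterated q-difference equations use
    it. *)
Lemma power_series_lim_0 (a : nat -> C) (K p : R) (z : C) (F : nat -> C) :
  0 < p < 1 -> (forall n, Cmod (a n) <= K) -> Cmod z < 1 ->
  (forall m, is_series (fun n => (z * p ^ m) ^ n * a n)%C (F m)) ->
  filterlim F eventually (locally (a 0%nat)).
Proof.
  intros Hp HK Hz HF. assert (Z := Cmod_ge_0 z).
  assert (K0 : 0 <= K) by (apply Rle_trans with (1 := Cmod_ge_0 (a 0%nat)), HK).
  apply C_filterlim_Cmod.
  apply is_lim_seq_le_le with (fun _ => 0)
    (fun m => Cmod z * (K / (1 - Cmod z)) * p ^ m).
  - intros m. split; [apply Cmod_ge_0|].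
    assert (P := Rpow_le_1 p m Hp).
    assert (Zm : Cmod (z * p ^ m) = Cmod z * p ^ m).
    { rewrite Cmod_mult, <- RtoC_pow, Cmod_pos_real by lra. reflexivity. }
    assert (Zl : Cmod z * p ^ m <= Cmod z) by nra.
    eapply Rle_trans.
    { apply (power_series_near_0 a K (z * p ^ m)%C (F m) HK); [|apply HF].
      rewrite Zm. lra. }
    rewrite Zm.
    replace (Cmod z * (K / (1 - Cmod z)) * p ^ m)
      with (Cmod z * p ^ m * (K / (1 - Cmod z))) by (unfold Rdiv; ring).
    apply Rmult_le_compat_l; [nra|].
    apply Rmult_le_compat_l; [exact K0|].
    apply Rinv_le_contravar; lra.
  - apply is_lim_seq_const.
  - replace (Finite 0) with (Rbar_mult (Cmod z * (K / (1 - Cmod z))) 0)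
      by (simpl; f_equal; ring).
    apply is_lim_seq_scal_l, is_lim_seq_geom. rewrite Rabs_pos_eq; lra.
Qed.

(** * Generating functions *)

Definition hcoef (p b : R) (n : nat) : R := qpoch b p n / qpoch p p n.

(** The product form is established only for real arguments, in [gser_real]. For complex [z] it is
    replaced by the recurrence [gser_rec] and the limit 1 along [z p^m]. *)
Definition gser (p b : R) (z : C) : C := CSeries (fun n => z ^ n * hcoef p b n)%C.

(* [vcoef] and [psi] are the coefficient and the value of [phi_sum], as functions
   of [X = p^n], with [p = q^2], [b = q^(2k)], [A = q^(2s+2)]. *)
Definition vcoef (p b A : R) (x j : nat) : R :=
  qpoch (p ^ x) (/ p) j * qpoch (p / (A * b * p ^ x)) (/ p) j
  / (qpoch (/ b) (/ p) j * qpoch (/ p) (/ p) j) * (/ p) ^ j.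

Definition psi (p b A : R) (x : nat) (X : R) : R :=
  sum_n (fun j => vcoef p b A x j * qpoch X (/ p) j) x.

(** This is [(z/A; 1/p)_x / (z b; p)_x], with the numerator in base [1/p]. *)
Definition Rfac (p b A : R) (x : nat) (z : C) : C :=
  Cprod (fun i => (1 - z / (A * p ^ i)) / (1 - z * b * p ^ i))%C x.

Lemma hcoef_rec (p b : R) (n : nat) : 0 < p < 1 ->
  hcoef p b (S n) * (1 - p ^ S n) = hcoef p b n * (1 - b * p ^ n).
Proof.
  intros Hp. unfold hcoef. simpl.
  assert (H1 := qpoch_bounds p p n Hp ltac:(lra)).
  assert (H2 := Rpow_lt_1 p n Hp). simpl in H2. field. lra.
Qed.

Lemma hcoef_0 (p b : R) : hcoef p b 0 = 1.
Proof. unfold hcoef. simpl. field. Qed.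

Lemma hcoef_pos (p b : R) (n : nat) : 0 < p < 1 -> 0 < b < 1 -> 0 < hcoef p b n.
Proof.
  intros Hp Hb. apply Rdiv_lt_0_compat; apply qpoch_bounds; lra.
Qed.

Lemma hcoef_bounded (p b : R) : 0 < p < 1 -> 0 < b < 1 ->
  exists K, 0 < K /\ forall n, hcoef p b n <= K.
Proof.
  intros Hp Hb. destruct (qpoch_lower p p Hp ltac:(lra)) as [L [HL Hn]].
  exists (/ L). split; [now apply Rinv_0_lt_compat|]. intros n. unfold hcoef.
  assert (H1 := qpoch_bounds b p n Hp ltac:(lra)).
  assert (H3 : / qpoch p p n <= / L) by (apply Rinv_le_contravar; auto).
  assert (0 < / qpoch p p n) by (apply Rinv_0_lt_compat; specialize (Hn n); lra).
  unfold Rdiv. nra.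
Qed.

Lemma Cmod_hcoef_bounded (p b : R) : 0 < p < 1 -> 0 < b < 1 ->
  exists K, forall n, Cmod (hcoef p b n) <= K.
Proof.
  intros Hp Hb. destruct (hcoef_bounded p b Hp Hb) as [K [_ HK]].
  exists K. intros n. rewrite Cmod_pos_real; [apply HK|].
  left. now apply hcoef_pos.
Qed.

Lemma gser_series (p b : R) (z : C) : 0 < p < 1 -> 0 < b < 1 -> Cmod z < 1 ->
  is_series (fun n => z ^ n * hcoef p b n)%C (gser p b z).
Proof.
  intros Hp Hb Hz. destruct (Cmod_hcoef_bounded p b Hp Hb) as [K HK].
  destruct (power_series_bounded (fun n => RtoC (hcoef p b n)) K z HK Hz) as [l Hl].
  unfold gser. now rewrite (CSeries_unique _ _ Hl).
Qed.

(** Writing [G] for [gser], [hcoef_rec] turns the series of [G(z) - G(zp)], after an index shift,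
    into that of [z (G(z) - b G(zp))]; the claim is a rearrangement. *)
Lemma gser_rec (p b : R) (z : C) : 0 < p < 1 -> 0 < b < 1 -> Cmod z < 1 ->
  ((1 - z) * gser p b z = (1 - z * b) * gser p b (z * p))%C.
Proof.
  intros Hp Hb Hz.
  assert (S1 := gser_series p b z Hp Hb Hz).
  assert (S2 := gser_series p b (z * p)%C Hp Hb
                  (Cmod_mult_real_lt z p Hz ltac:(lra))).
  assert (S3 : is_series (fun n => z * (z ^ n * hcoef p b n
      - b * ((z * p) ^ n * hcoef p b n)))%C
      (z * (gser p b z - b * gser p b (z * p)))%C).
  { apply is_series_Cmult_l, is_series_Cminus; [exact S1|].
    now apply is_series_Cmult_l. }
  assert (S4 := is_series_Cminus _ _ _ _ S1 S2).
  assert (S5 : is_series (fun n => z * (z ^ n * hcoef p b n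
      - b * ((z * p) ^ n * hcoef p b n)))%C
      (gser p b z - gser p b (z * p))%C).
  { apply (is_series_C_ext (fun n => (z ^ S n * hcoef p b (S n)
              - (z * p) ^ S n * hcoef p b (S n)))%C).
    - intros n. assert (E := f_equal RtoC (hcoef_rec p b n Hp)).
      rewrite !RtoC_mult, !RtoC_minus, RtoC_mult, !RtoC_pow in E.
      rewrite !Cpow_mult_l.
      transitivity (z ^ S n * (hcoef p b (S n) * (1 - p ^ S n)))%C; [ring|].
      rewrite E. simpl. ring.
    - apply (is_series_incr_1 (V := C_NormedModule)
        (fun n => z ^ n * hcoef p b n - (z * p) ^ n * hcoef p b n)%C).
      match goal with |- is_series _ ?u =>
        replace u with (gser p b z - gser p b (z * p))%C; [exact S4|] end.
      rewrite hcoef_0. simpl.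
      match goal with |- ?u = _ => change (u = u + (1 * 1 - 1 * 1))%C end. ring. }
  assert (E := is_series_C_unique _ _ _ S3 S5).
  transitivity (gser p b z - gser p b (z * p) + gser p b (z * p)
                - z * gser p b z)%C; [ring|].
  rewrite <- E. ring.
Qed.

Lemma gser_lim (p b : R) (z : C) : 0 < p < 1 -> 0 < b < 1 -> Cmod z < 1 ->
  filterlim (fun m => gser p b (z * p ^ m)%C) eventually (locally (RtoC 1)).
Proof.
  intros Hp Hb Hz. destruct (Cmod_hcoef_bounded p b Hp Hb) as [K HK].
  rewrite <- (hcoef_0 p b).
  apply (power_series_lim_0 (fun n => RtoC (hcoef p b n)) K p z); auto.
  intros m. apply gser_series; auto. rewrite <- RtoC_pow.
  apply Cmod_mult_real_lt; auto. assert (H := Rpow_le_1 p m Hp). lra.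
Qed.

Lemma gser_iter (p b : R) (z : C) (m : nat) :
  0 < p < 1 -> 0 < b < 1 -> Cmod z < 1 ->
  (Cprod (fun i => 1 - z * p ^ i) m * gser p b z
   = Cprod (fun i => 1 - z * b * p ^ i) m * gser p b (z * p ^ m))%C.
Proof.
  intros Hp Hb Hz. induction m as [|m IH].
  - cbn [Cprod Cpow]. now rewrite Cmult_1_r.
  - cbn [Cprod].
    transitivity ((1 - z * p ^ m) * (Cprod (fun i => 1 - z * p ^ i) m * gser p b z))%C;
      [ring|].
    rewrite IH.
    assert (R := gser_rec p b (z * p ^ m)%C Hp Hb).
    rewrite <- RtoC_pow in R at 1.
    assert (H := Rpow_le_1 p m Hp).
    specialize (R (Cmod_mult_real_lt z (p ^ m) Hz ltac:(lra))).
    transitivity (Cprod (fun i => 1 - z * b * p ^ i) m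
                  * ((1 - z * p ^ m) * gser p b (z * p ^ m)))%C; [ring|].
    rewrite R. replace (z * p ^ S m)%C with (z * p ^ m * p)%C by (simpl; ring).
    ring.
Qed.

Lemma filterlim_RtoC (u : nat -> R) (l : R) :
  is_lim_seq u l -> filterlim (fun n => RtoC (u n)) eventually (locally (RtoC l)).
Proof.
  intros H. apply C_filterlim_Cmod.
  apply (is_lim_seq_ext (fun n => Rabs (u n - l))).
  - intros n. now rewrite <- RtoC_minus, Cmod_R.
  - replace (Finite 0) with (Rbar_abs (Finite 0)) by (simpl; now rewrite Rabs_R0).
    apply is_lim_seq_abs. replace (Finite 0) with (Finite (l - l)) by (f_equal; ring).
    apply is_lim_seq_minus'; [exact H|apply is_lim_seq_const].
Qed.

Lemma filterlim_Cmult (u v : nat -> C) (a c : C) :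
  filterlim u eventually (locally a) -> filterlim v eventually (locally c) ->
  filterlim (fun n => u n * v n)%C eventually (locally (a * c)%C).
Proof.
  intros Hu Hv.
  assert (U := C_Cmod_filterlim _ _ Hu). assert (V := C_Cmod_filterlim _ _ Hv).
  assert (U0 := filterlim_Cmod _ _ Hu).
  apply C_filterlim_Cmod.
  apply is_lim_seq_le_le with (fun _ => 0)
    (fun n => Cmod (u n) * Cmod (v n - c) + Cmod c * Cmod (u n - a)).
  - intros n. split; [apply Cmod_ge_0|].
    replace (u n * v n - a * c)%C with (u n * (v n - c) + c * (u n - a))%C by ring.
    eapply Rle_trans; [apply Cmod_triangle|]. rewrite !Cmod_mult. lra.
  - apply is_lim_seq_const.
  - replace 0 with (Cmod a * 0 + Cmod c * 0) by ring.
    apply is_lim_seq_plus'; apply is_lim_seq_mult'; auto. apply is_lim_seq_const.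
Qed.

Lemma C_filterlim_unique (u : nat -> C) (a c : C) :
  filterlim u eventually (locally a) -> filterlim u eventually (locally c) -> a = c.
Proof.
  exact (filterlim_locally_unique (V := C_NormedModule) (F := eventually) u a c).
Qed.

(** Multiplied by [(a; p)_m], the left side becomes [(a b; p)_m * gser (a p^m)] by iteration; the
    limit in [m] is the q-binomial theorem. *)
Lemma gser_real (p b a : R) : 0 < p < 1 -> 0 < b < 1 -> 0 <= a < 1 ->
  gser p b a = RtoC (qpoch_inf (a * b) p / qpoch_inf a p).
Proof.
  intros Hp Hb Ha.
  destruct (qpoch_inf_correct a p Hp Ha) as [L1 P1].
  destruct (qpoch_inf_correct (a * b) p Hp ltac:(nra)) as [L2 P2].
  assert (Hz : Cmod a < 1) by (rewrite Cmod_pos_real; lra).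
  assert (E : (qpoch_inf a p * gser p b a = qpoch_inf (a * b) p * 1)%C).
  { apply (C_filterlim_unique (fun m => RtoC (qpoch a p m) * gser p b a)%C).
    - apply filterlim_Cmult; [now apply filterlim_RtoC|apply filterlim_const].
    - apply (filterlim_ext (fun m => RtoC (qpoch (a * b) p m) * gser p b (a * p ^ m))%C).
      + intros m. rewrite !RtoC_qpoch, (gser_iter p b a m Hp Hb Hz), RtoC_mult.
        reflexivity.
      + apply filterlim_Cmult; [now apply filterlim_RtoC|now apply gser_lim]. }
  assert (N : RtoC (qpoch_inf a p) <> 0) by (apply RtoC_neq_0; lra).
  rewrite RtoC_div by lra. rewrite Cmult_1_r in E. rewrite <- E. field. exact N.
Qed.

Lemma Cdenom_neq_0 (p b : R) (z : C) (i : nat) :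
  0 < p < 1 -> 0 < b < 1 -> Cmod z < 1 -> (1 - z * b * p ^ i)%C <> 0.
Proof.
  intros Hp Hb Hz. rewrite <- Cmult_assoc, <- RtoC_pow, <- RtoC_mult.
  apply Cminus_1_mult_neq_0; [exact Hz|].
  assert (H := Rpow_le_1 p i Hp). nra.
Qed.

(** The new factor [1 - p^n / p^j] in the coefficients acts on the sum [F] as [F(z) - F(zp) / p^j],
    and [gser_rec] expresses both parts through [gser z]. *)
Lemma gser_qpoch_series (p b : R) (j : nat) :
  0 < p < 1 -> 0 < b < 1 -> forall z : C, Cmod z < 1 ->
  is_series (fun n => z ^ n * (hcoef p b n * qpoch (p ^ n) (/ p) j)%R)%C
    (gser p b z * Cprod (fun i => z * (1 - b * p ^ i) / (1 - z * b * p ^ i)) j)%C.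
Proof.
  intros Hp Hb. induction j as [|j IH]; intros z Hz.
  - simpl. rewrite Cmult_1_r.
    apply (is_series_C_ext (fun n => z ^ n * hcoef p b n)%C).
    + intros n. now rewrite Rmult_1_r.
    + now apply gser_series.
  - assert (Hzp := Cmod_mult_real_lt z p Hz ltac:(lra)).
    assert (S1 := is_series_Cminus _ _ _ _ (IH z Hz)
                    (is_series_Cmult_l (/ p ^ j)%C _ _ (IH _ Hzp))).
    match type of S1 with is_series _ ?l =>
      match goal with |- is_series _ ?l' => assert (El : l = l') end end.
    { assert (D := fun i => Cdenom_neq_0 p b z i Hp Hb Hz).
      assert (Pj : (p ^ j)%C <> 0)
        by (rewrite <- RtoC_pow; apply RtoC_neq_0, pow_nonzero; lra).
      rewrite (Cprod_ext (fun i => z * p * (1 - b * p ^ i) / (1 - z * p * b * p ^ i))%C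
        (fun i => (p * (z * (1 - b * p ^ i))) / (1 - z * b * p ^ S i))%C).
      2:{ intros i _. simpl. f_equal; [ring|]. f_equal. ring. }
      rewrite !Cprod_div by (intros; apply D).
      rewrite (Cprod_mult (fun _ => RtoC p)).
      replace (Cprod (fun _ => RtoC p) j) with (p ^ j)%C.
      2:{ clear. induction j as [|j IH]; simpl; [reflexivity|]. rewrite <- IH. ring. }
      assert (S2 := Cprod_shift (fun i => 1 - z * b * p ^ i)%C j).
      assert (N1 : Cprod (fun i => 1 - z * b * p ^ i)%C j <> 0)
        by (apply Cprod_neq_0; intros; apply D).
      assert (N2 : Cprod (fun i => 1 - z * b * p ^ S i)%C j <> 0)
        by (apply Cprod_neq_0; intros; apply D).
      assert (D0 := D 0%nat). assert (Dj := D j).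
      cbv beta in S2, D0. change (p ^ 0)%C with (RtoC 1) in *.
      rewrite Cmult_1_r in S2, D0.
      assert (Rg := gser_rec p b z Hp Hb Hz).
      cbn [Cprod] in *. revert S2 N1 N2.
      generalize (Cprod (fun i => 1 - z * b * p ^ i)%C j),
        (Cprod (fun i => 1 - z * b * p ^ S i)%C j),
        (Cprod (fun i => z * (1 - b * p ^ i))%C j).
      intros d d' u S2 N1 N2.
      replace (gser p b (z * p)) with ((1 - z) * gser p b z / (1 - z * b))%C
        by (rewrite Rg; field; auto).
      replace d with ((1 - z * b) * d' / (1 - z * b * p ^ j))%C
        by (rewrite <- S2; field; auto).
      field. repeat split; auto. }
    rewrite El in S1. revert S1. apply is_series_C_ext. intros n.
    simpl qpoch. rewrite Cpow_mult_l, !RtoC_mult, !RtoC_minus, RtoC_mult, !RtoC_pow.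
    rewrite RtoC_inv by lra. rewrite Cpow_inv by (apply RtoC_neq_0; lra).
    field. rewrite <- RtoC_pow; apply RtoC_neq_0, pow_nonzero; lra.
Qed.

Lemma Cpow_RtoC_neq_0 (p : R) (n : nat) : 0 < p -> (RtoC p ^ n)%C <> 0.
Proof. intros Hp. rewrite <- RtoC_pow. apply RtoC_neq_0, pow_nonzero. lra. Qed.

Lemma qpoch_inv_neq_0 (a p : R) (n : nat) :
  0 < p < 1 -> 1 < a -> qpoch a (/ p) n <> 0.
Proof.
  intros Hp Ha. induction n as [|n IH]; simpl; [lra|].
  apply Rmult_integral_contrapositive_currified; [exact IH|].
  rewrite pow_inv. assert (P := Rpow_le_1 p n Hp).
  assert (1 <= / p ^ n) by (rewrite <- Rinv_1; apply Rinv_le_contravar; lra).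
  nra.
Qed.

Lemma Rinv_gt_1 (a : R) : 0 < a < 1 -> 1 < / a.
Proof. intros H. rewrite <- Rinv_1. apply Rinv_lt_contravar; lra. Qed.

Lemma RtoC_qpoch_inv (a p : R) (n : nat) : 0 < p ->
  RtoC (qpoch a (/ p) n) = Cprod (fun i => 1 - a / p ^ i)%C n.
Proof.
  intros Hp. rewrite RtoC_qpoch. apply Cprod_ext. intros i _.
  rewrite RtoC_inv by lra. rewrite Cpow_inv by (apply RtoC_neq_0; lra). reflexivity.
Qed.

Lemma Cprod_const (c : C) (n : nat) : Cprod (fun _ => c) n = (c ^ n)%C.
Proof. induction n as [|n IH]; simpl; [reflexivity|]. rewrite IH. ring. Qed.

Lemma vcoef_sum (p b A : R) (x : nat) (z : C) :
  0 < p < 1 -> 0 < b < 1 -> 0 < A -> Cmod z < 1 ->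
  sum_n (fun j => vcoef p b A x j
    * Cprod (fun i => z * (1 - b * p ^ i) / (1 - z * b * p ^ i)) j)%C x
  = Rfac p b A x z.
Proof.
  intros Hp Hb HA Hz.
  assert (D := fun i => Cdenom_neq_0 p b z i Hp Hb Hz).
  assert (HP := fun n => Cpow_RtoC_neq_0 p n (proj1 Hp)).
  assert (Np : RtoC p <> 0) by (apply RtoC_neq_0; lra).
  assert (Nb : RtoC b <> 0) by (apply RtoC_neq_0; lra).
  assert (NA : RtoC A <> 0) by (apply RtoC_neq_0; lra).
  assert (V := q_Vandermonde p x (RtoC (p / (A * b * p ^ x))) (z * b)%C HP).
  rewrite (sum_n_C_ext _ (fun j =>
    Cprod (fun i => 1 - p ^ x / p ^ i)%C j
    * Cprod (fun i => 1 - RtoC (p / (A * b * p ^ x)) / p ^ i)%C j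
    / Cprod (fun i => 1 - / p ^ S i)%C j / p ^ j
    * Cprod (fun i => - (z * b) * p ^ i / (1 - z * b * p ^ i))%C j)%C).
  - rewrite V.
    + unfold Rfac. rewrite !Cprod_div by (intros; apply D). f_equal.
      (* Here [beta * Gam * p^i = z / (A p^(x-1-i))], so the numerators of the q-Vandermonde sum
         come in the reverse order of those of [Rfac]. *)
      rewrite <- Cprod_rev. apply Cprod_ext. intros i Hi.
      assert (Px : (RtoC p ^ x = p ^ S (x - S i) * p ^ i)%C).
      { rewrite <- Cpow_add_r. f_equal. lia. }
      rewrite RtoC_div, !RtoC_mult, RtoC_pow.
      2:{ apply Rgt_not_eq, Rmult_lt_0_compat; [|now apply pow_lt].
          apply Rmult_lt_0_compat; lra. }
      rewrite Px. simpl. field. repeat split; auto.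
    + intros n. rewrite <- RtoC_pow, <- RtoC_minus. apply RtoC_neq_0.
      assert (P := Rpow_lt_1 p n Hp). lra.
    + exact D.
  - intros j _. unfold vcoef.
    assert (N1 := qpoch_inv_neq_0 (/ b) p j Hp (Rinv_gt_1 b Hb)).
    assert (N2 := qpoch_inv_neq_0 (/ p) p j Hp (Rinv_gt_1 p Hp)).
    rewrite RtoC_mult, RtoC_div by (now apply Rmult_integral_contrapositive_currified).
    rewrite !RtoC_mult.
    apply RtoC_neq_0 in N1. apply RtoC_neq_0 in N2.
    rewrite !RtoC_qpoch_inv in * by lra.
    rewrite !RtoC_pow. rewrite !RtoC_inv in * by lra.
    rewrite Cpow_inv by auto.
    rewrite (Cprod_ext (fun i => 1 - / p / p ^ i)%C (fun i => 1 - / p ^ S i)%C) in *.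
    2,3: intros i _; simpl; field; auto.
    (* Since [1 - b p^i = - b p^i (1 - 1/(b p^i))], the product [(1/b; 1/p)_j] in the denominator of
       [vcoef] cancels. *)
    rewrite (Cprod_ext (fun i => z * (1 - b * p ^ i) / (1 - z * b * p ^ i))%C
      (fun i => (1 - / b / p ^ i) * (- (z * b) * p ^ i / (1 - z * b * p ^ i)))%C).
    2:{ intros i _. field. auto. }
    rewrite Cprod_mult. field. auto.
Qed.

Lemma psi_series (p b A : R) (x : nat) (z : C) :
  0 < p < 1 -> 0 < b < 1 -> 0 < A -> Cmod z < 1 ->
  is_series (fun n => z ^ n * (hcoef p b n * psi p b A x (p ^ n))%R)%C
    (gser p b z * Rfac p b A x z)%C.
Proof.
  intros Hp Hb HA Hz.
  rewrite <- (vcoef_sum p b A x z Hp Hb HA Hz), <- sum_n_C_mult.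
  apply (is_series_C_ext (fun n => sum_n (fun j => vcoef p b A x j *
    (z ^ n * (hcoef p b n * qpoch (p ^ n) (/ p) j)%R))%C x)).
  - intros n. unfold psi.
    rewrite RtoC_mult, sum_n_RtoC.
    rewrite Cmult_assoc, <- sum_n_C_mult. apply sum_n_C_ext. intros j _.
    rewrite !RtoC_mult. ring.
  - apply is_series_C_sum_n. intros j.
    match goal with |- is_series _ ?u => replace u with (vcoef p b A x j *
      (gser p b z * Cprod (fun i => z * (1 - b * p ^ i) / (1 - z * b * p ^ i)) j))%C
      by ring end.
    now apply is_series_Cmult_l, gser_qpoch_series.
Qed.

(** * Expansion of [psi] in powers of its argument *)

Fixpoint qcoef (r : R) (j m : nat) : R :=
  match j with
  | O => match m with O => 1 | S _ => 0 end
  | S j' => qcoef r j' m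
            - r ^ j' * match m with O => 0 | S m' => qcoef r j' m' end
  end.

Lemma qcoef_gt (r : R) (j m : nat) : (j < m)%nat -> qcoef r j m = 0.
Proof.
  revert m. induction j as [|j IH]; intros [|m] H; simpl; try lia; [reflexivity|].
  rewrite !IH by lia. ring.
Qed.

Lemma qcoef_lead (r : R) (j : nat) :
  RtoC (qcoef r j j) = Cprod (fun i => - r ^ i)%C j.
Proof.
  induction j as [|j IH]; [reflexivity|].
  simpl. rewrite qcoef_gt by lia.
  rewrite RtoC_minus, RtoC_mult, IH, RtoC_pow. ring.
Qed.

Lemma sum_n_R_S (f : nat -> R) (n : nat) : sum_n f (S n) = sum_n f n + f (S n).
Proof. now rewrite sum_Sn. Qed.

Lemma qpoch_expand (X r : R) (j N : nat) : (j <= N)%nat ->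
  qpoch X r j = sum_n (fun m => qcoef r j m * X ^ m) N.
Proof.
  revert N. induction j as [|j IH]; intros N H.
  - clear H. induction N as [|N IHN]; [rewrite sum_O; simpl; ring|].
    rewrite sum_n_R_S, <- IHN. simpl. ring.
  - destruct N as [|N]; [lia|].
    simpl qpoch.
    transitivity (qpoch X r j - r ^ j * X * qpoch X r j); [ring|].
    (* The copy multiplied by [X] is expanded one degree lower, so that both parts end at
       [X^(S N)]. *)
    rewrite (IH (S N)) at 1 by lia. rewrite (IH N) by lia. clear IH H.
    induction N as [|N IHN].
    + rewrite !(sum_n_R_S _ 0), !sum_O. simpl. ring.
    + rewrite (sum_n_R_S _ (S N)), (sum_n_R_S (fun m => qcoef r (S j) m * X ^ m)).
      rewrite <- IHN, (sum_n_R_S _ N). simpl. ring.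
Qed.

Definition pcoef (p b A : R) (x m : nat) : R :=
  sum_n (fun j => vcoef p b A x j * qcoef (/ p) j m) x.

Lemma psi_expand (p b A : R) (x : nat) (X : R) :
  psi p b A x X = sum_n (fun m => pcoef p b A x m * X ^ m) x.
Proof.
  unfold psi, pcoef.
  transitivity (sum_n (fun j => sum_n (fun m =>
    vcoef p b A x j * qcoef (/ p) j m * X ^ m) x) x).
  - apply sum_n_ext_loc. intros j Hj. rewrite (qpoch_expand X (/ p) j x Hj).
    rewrite <- (sum_n_mult_l (K := R_Ring)). apply sum_n_ext. intros m.
    change (vcoef p b A x j * (qcoef (/ p) j m * X ^ m)
            = vcoef p b A x j * qcoef (/ p) j m * X ^ m). ring.
  - rewrite sum_n_switch. apply sum_n_ext. intros m.
    exact (sum_n_mult_r (K := R_Ring) (X ^ m) _ x).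
Qed.

Lemma pcoef_lead (p b A : R) (x : nat) :
  pcoef p b A x x = vcoef p b A x x * qcoef (/ p) x x.
Proof.
  unfold pcoef. destruct x as [|x]; [now rewrite sum_O|].
  rewrite sum_n_R_S.
  rewrite (sum_n_ext_loc _ (fun _ => 0)).
  - rewrite sum_n_const. ring.
  - intros j Hj. rewrite qcoef_gt by lia. apply Rmult_0_r.
Qed.

Lemma psi_bounded (p b A : R) (x : nat) : 0 < p < 1 ->
  exists K, forall n, Rabs (psi p b A x (p ^ n)) <= K.
Proof.
  intros Hp. exists (sum_n (fun m => Rabs (pcoef p b A x m)) x). intros n.
  rewrite psi_expand.
  eapply Rle_trans; [apply (norm_sum_n_m (V := R_NormedModule))|].
  apply sum_n_m_le. intros m.
  change (Rabs (pcoef p b A x m * (p ^ n) ^ m) <= Rabs (pcoef p b A x m)).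
  rewrite Rabs_mult, <- pow_mult.
  assert (P := Rpow_le_1 p (n * m) Hp).
  rewrite (Rabs_pos_eq (p ^ _)) by lra.
  assert (0 <= Rabs (pcoef p b A x m)) by apply Rabs_pos. nra.
Qed.

(** [X = 1] is the point [n = 0]: this value is the constant term of the generating function, needed
    for its limit at [z = 0]. *)
Lemma psi_1 (p b A : R) (x : nat) : psi p b A x 1 = 1.
Proof.
  unfold psi.
  assert (Z : forall j, qpoch 1 (/ p) (S j) = 0).
  { induction j as [|j IH]; [simpl; ring|].
    change (qpoch 1 (/ p) (S j) * (1 - 1 * (/ p) ^ S j) = 0). rewrite IH. ring. }
  assert (V : vcoef p b A x 0 = 1) by (unfold vcoef; simpl; field).
  (* The upper limit is separated from the parameter [x], so that the induction runs over the limit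
     alone. *)
  generalize x at 2. intros N. induction N as [|N IH].
  - rewrite sum_O, V. simpl. ring.
  - rewrite sum_n_R_S, IH, Z. ring.
Qed.

(** * The 6phi5 sum *)

(* [kap p A x = A^x p^(x(x-1))], written without truncated subtraction. *)
Fixpoint kap (p A : R) (x : nat) : R :=
  match x with
  | O => 1
  | S y => kap p A y * (A * (p ^ y * p ^ y))
  end.

Definition Vt (p b A : R) (x : nat) : R :=
  hcoef p b x * (qpoch (A * b) p x / qpoch A p x) * kap p A x.

(** The very-well-poised factor. Times [(A b; p)_x] it is [(a; p)_x (1 - a p^(2x)) / (1 - a)] with
    [a = A b / p], in a form that survives [a = 1]. *)
Definition wr (p b A : R) (x : nat) : R :=
  match x with
  | O => 1
  | S y => (1 - A * b * p * (p ^ y * p ^ y)) / (1 - A * b * p ^ y)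
  end.

Lemma Vt_rec (p b A : R) (x : nat) : 0 < p < 1 -> 0 < A < 1 ->
  Vt p b A (S x) = Vt p b A x * ((1 - b * p ^ x) / (1 - p * p ^ x)
    * ((1 - A * b * p ^ x) / (1 - A * p ^ x)) * (A * (p ^ x * p ^ x))).
Proof.
  intros Hp HA. unfold Vt, hcoef. simpl.
  assert (H1 := qpoch_bounds p p x Hp ltac:(lra)).
  assert (H2 := qpoch_bounds A p x Hp ltac:(lra)).
  assert (H3 := qpoch_factor_pos A p x Hp ltac:(lra)).
  assert (H4 := qpoch_factor_pos p p x Hp ltac:(lra)).
  field. lra.
Qed.

Lemma Rfac_S (p b A : R) (x : nat) (z : C) :
  Rfac p b A (S x) z
  = (Rfac p b A x z * ((1 - z / (A * p ^ x)) / (1 - z * b * p ^ x)))%C.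
Proof. reflexivity. Qed.

(** Replacing [z] by [z p] shifts the index of both products by one, in opposite directions. Taking
    [S x] on the left keeps all numerators of [Rfac x z] and adds only [1 - z p / A]. *)
Lemma Rfac_qshift (p b A : R) (x : nat) (z : C) :
  0 < p < 1 -> 0 < b < 1 -> 0 < A < 1 -> Cmod z < 1 ->
  Rfac p b A (S x) (z * p)%C
  = (Rfac p b A x z * ((1 - z * p / A) * (1 - z * b)
      / ((1 - z * b * p ^ x) * (1 - z * b * p ^ S x))))%C.
Proof.
  intros Hp Hb HA Hz.
  assert (D := fun i => Cdenom_neq_0 p b z i Hp Hb Hz).
  assert (HP := fun n => Cpow_RtoC_neq_0 p n (proj1 Hp)).
  assert (Np : RtoC p <> 0) by (apply RtoC_neq_0; lra).
  assert (NA : RtoC A <> 0) by (apply RtoC_neq_0; lra).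
  assert (D0 : (1 - z * b)%C <> 0).
  { specialize (D 0%nat). simpl in D. now rewrite Cmult_1_r in D. }
  induction x as [|x IH].
  - unfold Rfac. simpl. specialize (D 1%nat). simpl in D.
    rewrite !Cmult_1_r in *.
    replace (z * p * b)%C with (z * b * p)%C by ring.
    field. repeat split; auto.
  - rewrite Rfac_S, IH, Rfac_S.
    assert (D1 := D x). assert (D2 := D (S x)). assert (D3 := D (S (S x))).
    specialize (HP x). simpl in *.
    replace (z * p * b * (p * p ^ x))%C with (z * b * (p * (p * p ^ x)))%C by ring.
    field. repeat split; auto.
Qed.

(* The right-hand side is the q-Gosper antidifference of the summand. *)
Lemma telescoping (p b A : R) (z z' : C) (N : nat) :
  0 < p < 1 -> 0 < b < 1 -> 0 < A < 1 -> Cmod z < 1 -> Cmod z' < 1 ->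
  ((1 - z * z' / A) * (1 - z * b)
     * sum_n (fun x => RtoC (wr p b A x * Vt p b A x) * Rfac p b A x z * Rfac p b A x z') N
   - (1 - z * z' * b / A) * (1 - z)
     * sum_n (fun x => RtoC (wr p b A x * Vt p b A x) * Rfac p b A x (z * p)%C * Rfac p b A x z') N
   = Vt p b A N * Rfac p b A N z * Rfac p b A N z'
     * (z * (1 - b * p ^ N) * (p ^ N - z' / A) * ((1 - z * b) / (1 - z * b * p ^ N))))%C.
Proof.
  intros Hp Hb HA Hz Hz'.
  assert (D := fun i => Cdenom_neq_0 p b z i Hp Hb Hz).
  assert (D' := fun i => Cdenom_neq_0 p b z' i Hp Hb Hz').
  assert (HP := fun n => Cpow_RtoC_neq_0 p n (proj1 Hp)).
  assert (Np : RtoC p <> 0) by (apply RtoC_neq_0; lra).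
  assert (NA : RtoC A <> 0) by (apply RtoC_neq_0; lra).
  assert (D0 : (1 - z * b)%C <> 0).
  { specialize (D 0%nat). simpl in D. now rewrite Cmult_1_r in D. }
  induction N as [|N IH].
  - rewrite !sum_O. unfold Vt, hcoef, Rfac. simpl.
    replace (1 * (1 / 1 * (1 / 1) * 1)) with 1 by field.
    replace (1 / 1 * (1 / 1) * 1) with 1 by field.
    rewrite !Cmult_1_r. field. auto.
  - rewrite !sum_n_C_S.
    rewrite !Cmult_plus_distr_l.
    match goal with |- (?a + ?b - (?c + ?d))%C = _ =>
      transitivity ((a - c) + (b - d))%C; [ring|] end.
    rewrite IH. clear IH.
    rewrite (Rfac_qshift p b A N z Hp Hb HA Hz), !Rfac_S.
    rewrite RtoC_mult.
    assert (P := Rpow_le_1 p N Hp).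
    assert (F1 := qpoch_factor_pos (A * b) p N Hp ltac:(nra)).
    assert (F2 := qpoch_factor_pos A p N Hp ltac:(lra)).
    assert (F3 := qpoch_factor_pos p p N Hp ltac:(lra)).
    rewrite (Vt_rec p b A N Hp HA). simpl wr.
    assert (D1 := D N). assert (D2 := D (S N)). assert (D3 := D' N).
    specialize (HP N).
    assert (C1 : RtoC (1 - A * b * p ^ N) <> 0) by (apply RtoC_neq_0; lra).
    assert (C2 : RtoC (1 - A * p ^ N) <> 0) by (apply RtoC_neq_0; lra).
    assert (C3 : RtoC (1 - p * p ^ N) <> 0) by (apply RtoC_neq_0; lra).
    rewrite !RtoC_mult, !RtoC_div by lra.
    rewrite !RtoC_minus, !RtoC_mult, !RtoC_pow in *.
    simpl in D2 |- *.
    (* All terms are now rational multiples of the same product at [N]; with [X = p^N] a rational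
       identity is left. *)
    generalize dependent (RtoC p ^ N)%C. intros X ? ? ? ? ?.
    generalize (RtoC (Vt p b A N)), (Rfac p b A N z), (Rfac p b A N z').
    intros. field. repeat split; auto.
Qed.

(** * Estimates for the sum over [x] *)

Lemma Cmod_sub_real_le (z : C) (r rho : R) :
  0 <= r -> Cmod z <= rho -> Cmod (r - z) <= r + rho.
Proof.
  intros Hr Hz. unfold Cminus. eapply Rle_trans; [apply Cmod_triangle|].
  rewrite Cmod_opp, Cmod_pos_real by lra. lra.
Qed.

(** Each factor [A p^(2i)] of [kap] clears the denominators of the two numerators at [i], leaving
    [(A p^i - z) (A p^i - z') / A]. This tends to [z z' / A], the origin of the geometric ratio and
    of the convergence region. *)
Lemma kap_numerators_le (p A : R) (rho rho' : R) (z z' : C) (x : nat) :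
  0 < p < 1 -> 0 < A -> 0 < rho -> 0 < rho' ->
  Cmod z <= rho -> Cmod z' <= rho' ->
  Cmod (kap p A x * Cprod (fun i => 1 - z / (A * p ^ i)) x
        * Cprod (fun i => 1 - z' / (A * p ^ i)) x)%C
  <= qpoch (- (A / rho)) p x * qpoch (- (A / rho')) p x * (rho * rho' / A) ^ x.
Proof.
  intros Hp HA Hr Hr' Hz Hz'.
  assert (NA : RtoC A <> 0) by (apply RtoC_neq_0; lra).
  induction x as [|x IH].
  - simpl. rewrite !Cmult_1_r, Cmod_1. lra.
  - simpl Cprod. simpl kap. simpl qpoch. simpl pow.
    assert (HP := Cpow_RtoC_neq_0 p x (proj1 Hp)).
    assert (P := Rpow_le_1 p x Hp).
    assert (B : Cmod ((RtoC (A * p ^ x)%R - z) * (RtoC (A * p ^ x)%R - z') * RtoC (/ A)%R)%C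
       <= (1 - - (A / rho) * p ^ x) * (1 - - (A / rho') * p ^ x) * (rho * rho' / A)).
    { rewrite !Cmod_mult.
      rewrite (Cmod_pos_real (/ A)) by (left; apply Rinv_0_lt_compat; lra).
      replace ((1 - - (A / rho) * p ^ x) * (1 - - (A / rho') * p ^ x) * (rho * rho' / A))
        with ((A * p ^ x + rho) * (A * p ^ x + rho') * / A) by (field; lra).
      apply Rmult_le_compat_r; [left; apply Rinv_0_lt_compat; lra|].
      apply Rmult_le_compat; try apply Cmod_ge_0;
        apply Cmod_sub_real_le; auto; nra. }
    match goal with |- Cmod ?u <= _ => replace u with
      ((kap p A x * Cprod (fun i => 1 - z / (A * p ^ i)) x
        * Cprod (fun i => 1 - z' / (A * p ^ i)) x)
       * ((RtoC (A * p ^ x)%R - z) * (RtoC (A * p ^ x)%R - z') * RtoC (/ A)%R))%C end.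
    2:{ rewrite RtoC_inv by lra. rewrite !RtoC_mult, !RtoC_pow. field. auto. }
    rewrite Cmod_mult.
    eapply Rle_trans.
    { apply Rmult_le_compat; [apply Cmod_ge_0|apply Cmod_ge_0|exact IH|exact B]. }
    right. ring.
Qed.

Lemma Cprod_denominators_ge (p b rho : R) (z : C) (x : nat) :
  0 < p < 1 -> 0 < b < 1 -> 0 < rho < 1 -> Cmod z <= rho ->
  qpoch (rho * b) p x <= Cmod (Cprod (fun i => 1 - z * b * p ^ i)%C x).
Proof.
  intros Hp Hb Hr Hz. induction x as [|x IH].
  - simpl. rewrite Cmod_1. lra.
  - simpl. rewrite Cmod_mult.
    assert (P := Rpow_le_1 p x Hp).
    assert (Q := qpoch_bounds (rho * b) p x Hp ltac:(nra)).
    assert (0 <= rho * b <= 1) by nra.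
    apply Rmult_le_compat; [lra|nra|exact IH|].
    assert (T := Cmod_triangle (1 - z * b * p ^ x)%C (z * b * p ^ x)%C).
    replace (1 - z * b * p ^ x + z * b * p ^ x)%C with (RtoC 1) in T by ring.
    rewrite Cmod_1, !Cmod_mult, <- RtoC_pow, (Cmod_pos_real b),
      (Cmod_pos_real (p ^ x)) in T by lra.
    rewrite <- RtoC_pow.
    assert (Cmod z * b * p ^ x <= rho * b * p ^ x).
    { rewrite !Rmult_assoc. apply Rmult_le_compat_r; [nra|exact Hz]. }
    lra.
Qed.

(** The bound is in terms of radii and not of [|z|], since one constant has to serve all points
    [z p^m] and also [z = 0]. *)
Lemma Vt_Rfac_bound (p b A rho rho' : R) :
  0 < p < 1 -> 0 < b < 1 -> 0 < A < 1 -> 0 < rho < 1 -> 0 < rho' < 1 ->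
  exists K, forall (x : nat) (z z' : C), Cmod z <= rho -> Cmod z' <= rho' ->
    Cmod (Vt p b A x * Rfac p b A x z * Rfac p b A x z')%C
    <= K * (rho * rho' / A) ^ x.
Proof.
  intros Hp Hb HA Hr Hr'.
  destruct (hcoef_bounded p b Hp Hb) as [Kh [Kh0 Hh]].
  destruct (qpoch_lower A p Hp ltac:(lra)) as [LA [LA0 HLA]].
  destruct (qpoch_lower (rho * b) p Hp ltac:(nra)) as [L1 [L10 HL1]].
  destruct (qpoch_lower (rho' * b) p Hp ltac:(nra)) as [L2 [L20 HL2]].
  assert (Q1 : 0 <= A / rho) by (apply Rlt_le, Rdiv_lt_0_compat; lra).
  assert (Q2 : 0 <= A / rho') by (apply Rlt_le, Rdiv_lt_0_compat; lra).
  destruct (qpoch_upper (A / rho) p Hp Q1) as [U1 [U10 HU1]].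
  destruct (qpoch_upper (A / rho') p Hp Q2) as [U2 [U20 HU2]].
  exists (Kh * / LA * / L1 * / L2 * (U1 * U2)). intros x z z' Hz Hz'.
  assert (Hz1 : Cmod z < 1) by lra. assert (Hz1' : Cmod z' < 1) by lra.
  assert (D := fun i => Cdenom_neq_0 p b z i Hp Hb Hz1).
  assert (D' := fun i => Cdenom_neq_0 p b z' i Hp Hb Hz1').
  assert (N1 := Cprod_neq_0 _ x (fun i _ => D i)).
  assert (N2 := Cprod_neq_0 _ x (fun i _ => D' i)).
  unfold Rfac. rewrite !Cprod_div by auto.
  unfold Vt.
  assert (HA1 := qpoch_bounds A p x Hp ltac:(lra)).
  assert (HA2 := qpoch_bounds (A * b) p x Hp ltac:(nra)).
  assert (Hh0 := hcoef_pos p b x Hp Hb).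
  match goal with |- Cmod ?u <= _ => replace u with
    (RtoC (hcoef p b x * (qpoch (A * b) p x / qpoch A p x))
     * / Cprod (fun i => 1 - z * b * p ^ i) x
     * / Cprod (fun i => 1 - z' * b * p ^ i) x
     * (kap p A x * Cprod (fun i => 1 - z / (A * p ^ i)) x
        * Cprod (fun i => 1 - z' / (A * p ^ i)) x))%C
    by (rewrite (RtoC_mult _ (kap p A x)); field; auto) end.
  rewrite 3!(Cmod_mult _ _), !Cmod_inv by auto.
  rewrite Rmult_assoc with (r1 := Kh * / LA * / L1 * / L2).
  assert (B := kap_numerators_le p A rho rho' z z' x Hp (proj1 HA)
                 (proj1 Hr) (proj1 Hr') Hz Hz').
  assert (B1 := Cprod_denominators_ge p b rho z x Hp Hb Hr Hz).
  assert (B2 := Cprod_denominators_ge p b rho' z' x Hp Hb Hr' Hz').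
  specialize (Hh x). specialize (HLA x). specialize (HL1 x). specialize (HL2 x).
  specialize (HU1 x). specialize (HU2 x).
  assert (I1 := Rinv_le_contravar _ _ L10 (Rle_trans _ _ _ HL1 B1)).
  assert (I2 := Rinv_le_contravar _ _ L20 (Rle_trans _ _ _ HL2 B2)).
  assert (I3 := Rinv_le_contravar _ _ LA0 HLA).
  assert (J1 := Rinv_0_lt_compat _ L10). assert (J2 := Rinv_0_lt_compat _ L20).
  assert (J3 := Rinv_0_lt_compat _ LA0).
  assert (J4 := Rinv_0_lt_compat _ (proj1 HA1)).
  assert (J5 := Rinv_0_lt_compat _ (Rlt_le_trans _ _ _ L10 (Rle_trans _ _ _ HL1 B1))).
  assert (J6 := Rinv_0_lt_compat _ (Rlt_le_trans _ _ _ L20 (Rle_trans _ _ _ HL2 B2))).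
  assert (W1 : hcoef p b x * (qpoch (A * b) p x / qpoch A p x) <= Kh * / LA).
  { unfold Rdiv. apply Rmult_le_compat; nra. }
  assert (W0 : 0 <= hcoef p b x * (qpoch (A * b) p x / qpoch A p x)).
  { unfold Rdiv. apply Rmult_le_pos; nra. }
  rewrite Cmod_pos_real by exact W0.
  assert (R0 : 0 <= (rho * rho' / A) ^ x).
  { apply pow_le, Rlt_le, Rdiv_lt_0_compat; nra. }
  apply Rmult_le_compat.
  - apply Rmult_le_pos; [apply Rmult_le_pos|]; lra.
  - apply Cmod_ge_0.
  - apply Rmult_le_compat; [apply Rmult_le_pos; lra|lra| |exact I2].
    apply Rmult_le_compat; lra.
  - eapply Rle_trans; [exact B|].
    apply Rmult_le_compat_r; [exact R0|].
    apply Rmult_le_compat; lra.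
Qed.

Lemma wr_bound (p b A : R) (x : nat) : 0 < p < 1 -> 0 < b < 1 -> 0 < A < 1 ->
  0 < wr p b A x <= / (1 - A * b).
Proof.
  intros Hp Hb HA. assert (0 < A * b < 1) by nra.
  assert (I : 1 <= / (1 - A * b))
    by (rewrite <- Rinv_1; apply Rinv_le_contravar; lra).
  destruct x as [|x]; simpl; [lra|].
  assert (P := Rpow_le_1 p x Hp).
  assert (A * b * p ^ x <= A * b) by nra.
  assert (0 < p * (p ^ x * p ^ x) < 1).
  { assert (0 < p ^ x * p ^ x <= 1) by nra. nra. }
  assert (0 < A * b * p * (p ^ x * p ^ x) < 1).
  { rewrite (Rmult_assoc (A * b)). nra. }
  split; [apply Rdiv_lt_0_compat; lra|].
  unfold Rdiv. rewrite <- (Rmult_1_l (/ (1 - A * b))).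
  assert (0 < / (1 - A * b * p ^ x)) by (apply Rinv_0_lt_compat; lra).
  apply Rmult_le_compat; try lra. apply Rinv_le_contravar; lra.
Qed.

Definition Sterm (p b A : R) (z z' : C) (x : nat) : C :=
  (RtoC (wr p b A x * Vt p b A x) * Rfac p b A x z * Rfac p b A x z')%C.

Definition Sser (p b A : R) (z z' : C) : C := CSeries (Sterm p b A z z').

Lemma Sterm_bound (p b A rho rho' : R) :
  0 < p < 1 -> 0 < b < 1 -> 0 < A < 1 -> 0 < rho < 1 -> 0 < rho' < 1 ->
  exists K, forall (x : nat) (z z' : C), Cmod z <= rho -> Cmod z' <= rho' ->
    Cmod (Sterm p b A z z' x) <= K * (rho * rho' / A) ^ x.
Proof.
  intros Hp Hb HA Hr Hr'.
  destruct (Vt_Rfac_bound p b A rho rho' Hp Hb HA Hr Hr') as [K HK].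
  exists (/ (1 - A * b) * K). intros x z z' Hz Hz'.
  assert (W := wr_bound p b A x Hp Hb HA).
  unfold Sterm. rewrite RtoC_mult, <- 2!Cmult_assoc, Cmod_mult, Cmult_assoc.
  rewrite Cmod_pos_real by lra. rewrite Rmult_assoc.
  apply Rmult_le_compat; [lra|apply Cmod_ge_0|lra|now apply HK].
Qed.

Lemma ex_series_geom_scal (K r : R) :
  0 < r < 1 -> ex_series (fun x => K * r ^ x).
Proof.
  intros Hr. apply (ex_series_scal_l (V := R_NormedModule)).
  apply ex_series_geom. rewrite Rabs_pos_eq; lra.
Qed.

Lemma ratio_bound (A rho rho' : R) :
  0 < A -> 0 < rho -> 0 < rho' -> rho * rho' < A -> 0 < rho * rho' / A < 1.
Proof.
  intros HA Hr Hr' H. split; [apply Rdiv_lt_0_compat; nra|].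
  apply Rmult_lt_reg_r with A; [lra|]. unfold Rdiv.
  rewrite Rmult_assoc, Rinv_l by lra. lra.
Qed.

Lemma Sser_series (p b A rho rho' : R) (z z' : C) :
  0 < p < 1 -> 0 < b < 1 -> 0 < A < 1 -> 0 < rho < 1 -> 0 < rho' < 1 ->
  rho * rho' < A -> Cmod z <= rho -> Cmod z' <= rho' ->
  is_series (Sterm p b A z z') (Sser p b A z z').
Proof.
  intros Hp Hb HA Hr Hr' Hrr Hz Hz'.
  destruct (Sterm_bound p b A rho rho' Hp Hb HA Hr Hr') as [K HK].
  destruct (ex_series_C_le (Sterm p b A z z') (fun x => K * (rho * rho' / A) ^ x))
    as [l Hl].
  - intros x. now apply HK.
  - apply ex_series_geom_scal, ratio_bound; lra.
  - unfold Sser. now rewrite (CSeries_unique _ _ Hl).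
Qed.

Lemma sum_n_Cminus (u v : nat -> C) (N : nat) :
  sum_n (fun n => u n - v n)%C N = (sum_n u N - sum_n v N)%C.
Proof.
  induction N as [|N IH]; [now rewrite !sum_O|].
  rewrite !sum_n_C_S, IH.
  match goal with |- @eq _ ?x ?y => change (@eq C x y) end. ring.
Qed.

Lemma telescoping_remainder_lim (p b A rho rho' : R) (z z' : C) :
  0 < p < 1 -> 0 < b < 1 -> 0 < A < 1 -> 0 < rho < 1 -> 0 < rho' < 1 ->
  rho * rho' < A -> Cmod z <= rho -> Cmod z' <= rho' ->
  filterlim (fun N => Vt p b A N * Rfac p b A N z * Rfac p b A N z'
     * (z * (1 - b * p ^ N) * (p ^ N - z' / A) * ((1 - z * b) / (1 - z * b * p ^ N))))%C
   eventually (locally (RtoC 0)).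
Proof.
  intros Hp Hb HA Hr Hr' Hrr Hz Hz'.
  destruct (Vt_Rfac_bound p b A rho rho' Hp Hb HA Hr Hr') as [K HK].
  assert (Q := ratio_bound A rho rho' (proj1 HA) (proj1 Hr) (proj1 Hr') Hrr).
  (* The three factors bound [z (1 - b p^N)], [p^N - z'/A] and [(1 - z b) / (1 - z b p^N)]. *)
  set (M := 1 * (1 + / A) * (2 * / (1 - b))).
  apply C_filterlim_Cmod.
  apply is_lim_seq_le_le with (fun _ => 0) (fun N => M * K * (rho * rho' / A) ^ N).
  - intros N. split; [apply Cmod_ge_0|].
    unfold Cminus at 1. rewrite Copp_0, Cplus_0_r.
    rewrite (Cmod_mult (Vt p b A N * Rfac p b A N z * Rfac p b A N z')%C).
    replace (M * K * (rho * rho' / A) ^ N) with (K * (rho * rho' / A) ^ N * M) by ring.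
    apply Rmult_le_compat; [apply Cmod_ge_0|apply Cmod_ge_0|now apply HK|].
    assert (P := Rpow_le_1 p N Hp).
    assert (Z0 := Cmod_ge_0 z). assert (Z0' := Cmod_ge_0 z').
    rewrite !Cmod_mult, <- RtoC_pow.
    assert (IA : 0 < / A) by (apply Rinv_0_lt_compat; lra).
    assert (Ib : 0 < / (1 - b)) by (apply Rinv_0_lt_compat; lra).
    unfold M. apply Rmult_le_compat.
    + apply Rmult_le_pos; [apply Rmult_le_pos|]; apply Cmod_ge_0.
    + apply Cmod_ge_0.
    + apply Rmult_le_compat.
      * apply Rmult_le_pos; apply Cmod_ge_0.
      * apply Cmod_ge_0.
      * assert (0 < b * p ^ N < 1) by nra.
        rewrite <- RtoC_mult, <- RtoC_minus, Cmod_pos_real by lra.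
        assert (Cmod z < 1) by lra. nra.
      * unfold Cminus. eapply Rle_trans; [apply Cmod_triangle|].
        rewrite Cmod_opp, Cmod_div by (apply RtoC_neq_0; lra).
        rewrite !Cmod_pos_real by lra. unfold Rdiv. nra.
    + assert (Dn := Cdenom_neq_0 p b z N Hp Hb ltac:(lra)).
      rewrite <- RtoC_pow in Dn.
      unfold Cdiv. rewrite Cmod_mult, Cmod_inv by exact Dn.
      apply Rmult_le_compat.
      * apply Cmod_ge_0.
      * left. apply Rinv_0_lt_compat, Cmod_gt_0. exact Dn.
      * unfold Cminus. eapply Rle_trans; [apply Cmod_triangle|].
        rewrite Cmod_opp, Cmod_mult, !Cmod_pos_real by lra. nra.
      * apply Rinv_le_contravar; [lra|].
        assert (T := Cmod_triangle (1 - z * b * RtoC (p ^ N))%C (z * b * RtoC (p ^ N))%C).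
        replace (1 - z * b * RtoC (p ^ N) + z * b * RtoC (p ^ N))%C
          with (RtoC 1) in T by ring.
        rewrite Cmod_1, !Cmod_mult, (Cmod_pos_real b),
          (Cmod_pos_real (p ^ N)) in T by lra.
        assert (Cmod z * b * p ^ N <= b).
        { assert (0 < b * p ^ N <= b) by nra. nra. }
        lra.
  - apply is_lim_seq_const.
  - replace (Finite 0) with (Rbar_mult (M * K) 0) by (simpl; f_equal; ring).
    apply is_lim_seq_scal_l, is_lim_seq_geom. rewrite Rabs_pos_eq; lra.
Qed.

(** * Recurrence in [z] and evaluation of the sum *)

Lemma Cmod_qshift_le (p rho : R) (z : C) (m : nat) :
  0 < p < 1 -> Cmod z <= rho -> Cmod (z * p ^ m)%C <= rho.
Proof.
  intros Hp Hz. rewrite Cmod_mult, <- RtoC_pow.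
  assert (P := Rpow_le_1 p m Hp). assert (Z := Cmod_ge_0 z).
  rewrite Cmod_pos_real by lra. nra.
Qed.

(** The factor [gser z] absorbs [(1 - z) / (1 - z b)] from the telescoped identity, so that
    [gser z * Sser z z'] obeys the same recurrence as [gser (z z' / A)]. *)
Lemma Sser_rec (p b A rho rho' : R) (z z' : C) :
  0 < p < 1 -> 0 < b < 1 -> 0 < A < 1 -> 0 < rho < 1 -> 0 < rho' < 1 ->
  rho * rho' < A -> Cmod z <= rho -> Cmod z' <= rho' ->
  ((1 - z * z' / A) * (gser p b z * Sser p b A z z')
   = (1 - z * z' / A * b) * (gser p b (z * p) * Sser p b A (z * p) z'))%C.
Proof.
  intros Hp Hb HA Hr Hr' Hrr Hz Hz'.
  assert (S1 := Sser_series p b A rho rho' z z' Hp Hb HA Hr Hr' Hrr Hz Hz').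
  assert (Hzp : Cmod (z * p)%C <= rho).
  { assert (H := Cmod_qshift_le p rho z 1 Hp Hz). now rewrite Cpow_1_r in H. }
  assert (S2 := Sser_series p b A rho rho' (z * p)%C z' Hp Hb HA Hr Hr' Hrr Hzp Hz').
  assert (S3 := is_series_Cminus _ _ _ _
     (is_series_Cmult_l ((1 - z * z' / A) * (1 - z * b))%C _ _ S1)
     (is_series_Cmult_l ((1 - z * z' * b / A) * (1 - z))%C _ _ S2)).
  assert (L := telescoping_remainder_lim p b A rho rho' z z'
                 Hp Hb HA Hr Hr' Hrr Hz Hz').
  assert (E : ((1 - z * z' / A) * (1 - z * b) * Sser p b A z z'
     - (1 - z * z' * b / A) * (1 - z) * Sser p b A (z * p) z' = 0)%C).
  { refine (C_filterlim_unique _ _ _ _ L).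
    refine (filterlim_ext _ _ _ S3). intros N.
    rewrite <- (telescoping p b A z z' N Hp Hb HA) by lra.
    rewrite <- !sum_n_C_mult. apply sum_n_Cminus. }
  assert (G := gser_rec p b z Hp Hb ltac:(lra)).
  assert (D := Cdenom_neq_0 p b z 0 Hp Hb ltac:(lra)).
  simpl in D. rewrite Cmult_1_r in D.
  assert (NA : RtoC A <> 0) by (apply RtoC_neq_0; lra).
  assert (G' : gser p b (z * p)%C = ((1 - z) * gser p b z / (1 - z * b))%C)
    by (rewrite G; field; exact D).
  rewrite G'.
  transitivity (((1 - z * z' / A) * (1 - z * b) * Sser p b A z z')
                * gser p b z / (1 - z * b))%C; [field; auto|].
  transitivity (((1 - z * z' * b / A) * (1 - z) * Sser p b A (z * p) z')
                * gser p b z / (1 - z * b))%C; [|field; auto].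
  f_equal. f_equal.
  match type of E with (?u - ?v)%C = _ =>
    transitivity (u - v + v)%C; [ring|rewrite E; ring] end.
Qed.

(** By [psi_series] the product is a power series with bounded coefficients, and its constant term
    is 1. *)
Lemma Rfac_lim_0 (p b A : R) (x : nat) (z : C) :
  0 < p < 1 -> 0 < b < 1 -> 0 < A -> Cmod z < 1 ->
  filterlim (fun m => gser p b (z * p ^ m)%C * Rfac p b A x (z * p ^ m)%C)%C
    eventually (locally (RtoC 1)).
Proof.
  intros Hp Hb HA Hz.
  destruct (hcoef_bounded p b Hp Hb) as [K [K0 HK]].
  destruct (psi_bounded p b A x Hp) as [K' HK'].
  assert (E : RtoC 1 = RtoC (hcoef p b 0 * psi p b A x (p ^ 0))).
  { simpl. rewrite psi_1, hcoef_0. f_equal. ring. }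
  rewrite E.
  apply (power_series_lim_0 (fun n => RtoC (hcoef p b n * psi p b A x (p ^ n)))
           (K * K') p z); auto.
  - intros n. rewrite Cmod_R, Rabs_mult.
    assert (H := hcoef_pos p b n Hp Hb).
    apply Rmult_le_compat; try apply Rabs_pos; [|apply HK'].
    rewrite Rabs_pos_eq by lra. apply HK.
  - intros m. apply psi_series; auto.
    eapply Rle_lt_trans; [apply (Cmod_qshift_le p (Cmod z) z m Hp); lra|exact Hz].
Qed.

Lemma gser_bounded (p b rho : R) : 0 < p < 1 -> 0 < b < 1 -> 0 < rho < 1 ->
  exists K, 0 <= K /\ forall z, Cmod z <= rho -> Cmod (gser p b z) <= K.
Proof.
  intros Hp Hb Hr. destruct (Cmod_hcoef_bounded p b Hp Hb) as [K HK].
  assert (K0 : 0 <= K) by (eapply Rle_trans; [apply Cmod_ge_0|apply (HK 0%nat)]).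
  assert (B : forall z, Cmod z <= rho ->
            Cmod (gser p b z) <= Series (fun n => K * rho ^ n)).
  { intros z Hz. eapply Cmod_series_le; [|apply ex_series_geom_scal, Hr|
      apply gser_series; auto; lra].
    intros n. cbv beta. rewrite Cmod_mult, Cmod_pow, Rmult_comm.
    apply Rmult_le_compat; [apply Cmod_ge_0|apply pow_le, Cmod_ge_0|apply HK|].
    apply pow_incr. split; [apply Cmod_ge_0|exact Hz]. }
  eexists. split; [|exact B].
  eapply Rle_trans; [apply Cmod_ge_0|apply (B 0)]. rewrite Cmod_0. lra.
Qed.

(** The bounds uniform in [|z| <= rho] allow [tannery]. The factor [gser], which tends to 1, stays
    inside because [Rfac_lim_0] gives the termwise limit of the product. *)
Lemma Sser_lim_0 (p b A rho rho' : R) (z z' : C) :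
  0 < p < 1 -> 0 < b < 1 -> 0 < A < 1 -> 0 < rho < 1 -> 0 < rho' < 1 ->
  rho * rho' < A -> Cmod z <= rho -> Cmod z' <= rho' ->
  filterlim (fun m => gser p b (z * p ^ m)%C * Sser p b A (z * p ^ m)%C z')%C
    eventually (locally (Sser p b A 0 z')).
Proof.
  intros Hp Hb HA Hr Hr' Hrr Hz Hz'.
  destruct (gser_bounded p b rho Hp Hb Hr) as [Kg [Kg0 HKg]].
  destruct (Sterm_bound p b A rho rho' Hp Hb HA Hr Hr') as [K HK].
  apply (tannery
    (fun m x => gser p b (z * p ^ m) * Sterm p b A (z * p ^ m) z' x)%C
    (Sterm p b A 0 z') (fun x => Kg * K * (rho * rho' / A) ^ x)).
  - intros m x. rewrite Cmod_mult, Rmult_assoc.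
    apply Rmult_le_compat; try apply Cmod_ge_0; [apply HKg|apply HK; auto];
      now apply Cmod_qshift_le.
  - apply ex_series_geom_scal, ratio_bound; lra.
  - intros x. unfold Sterm.
    apply (filterlim_ext (fun m => RtoC (wr p b A x * Vt p b A x) * Rfac p b A x z'
      * (gser p b (z * p ^ m) * Rfac p b A x (z * p ^ m)))%C).
    { intros m. ring. }
    assert (R0 : Rfac p b A x 0 = 1).
    { unfold Rfac. rewrite (Cprod_ext _ (fun _ => RtoC 1)).
      - rewrite Cprod_const. apply Cpow_1_l.
      - intros i _. unfold Cdiv. rewrite !Cmult_0_l. unfold Cminus.
        rewrite Copp_0, Cplus_0_r. field. }
    rewrite R0.
    match goal with |- filterlim _ _ (locally ?u) => replace u with
      (RtoC (wr p b A x * Vt p b A x) * Rfac p b A x z' * 1)%C by ring end.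
    apply filterlim_Cmult; [apply filterlim_const|apply Rfac_lim_0; lra].
  - intros m. apply is_series_Cmult_l.
    apply (Sser_series p b A rho rho'); auto. now apply Cmod_qshift_le.
  - apply (Sser_series p b A rho rho'); auto. rewrite Cmod_0. lra.
Qed.

Lemma Cmod_w_lt (A rho rho' : R) (z z' : C) :
  0 < A -> 0 < rho -> 0 < rho' -> rho * rho' < A ->
  Cmod z <= rho -> Cmod z' <= rho' -> Cmod (z * z' / A)%C < 1.
Proof.
  intros HA Hr Hr' Hrr Hz Hz'.
  rewrite Cmod_div by (apply RtoC_neq_0; lra).
  rewrite Cmod_mult, Cmod_pos_real by lra.
  assert (Q := ratio_bound A rho rho' HA Hr Hr' Hrr).
  eapply Rle_lt_trans; [|apply Q].
  apply Rmult_le_compat_r; [left; apply Rinv_0_lt_compat; lra|].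
  apply Rmult_le_compat; auto; apply Cmod_ge_0.
Qed.

(** The ratio of [gser z * Sser z z'] to [gser (z z' / A)] is invariant under [z -> z p], hence
    equal to its limit at 0. Everything is cross-multiplied to avoid dividing by [gser] at complex
    arguments. *)
Lemma Sser_via_0 (p b A rho rho' : R) (z z' : C) :
  0 < p < 1 -> 0 < b < 1 -> 0 < A < 1 -> 0 < rho < 1 -> 0 < rho' < 1 ->
  rho * rho' < A -> Cmod z <= rho -> Cmod z' <= rho' ->
  (gser p b z * Sser p b A z z' = Sser p b A 0 z' * gser p b (z * z' / A))%C.
Proof.
  intros Hp Hb HA Hr Hr' Hrr Hz Hz'.
  assert (Hw := Cmod_w_lt A rho rho' z z' (proj1 HA) (proj1 Hr) (proj1 Hr') Hrr Hz Hz').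
  assert (It : forall m, (gser p b z * Sser p b A z z' * gser p b (z * z' / A * p ^ m)
    = gser p b (z * p ^ m) * Sser p b A (z * p ^ m) z' * gser p b (z * z' / A))%C).
  { induction m as [|m IH].
    - simpl. now rewrite !Cmult_1_r.
    - assert (Hzm := Cmod_qshift_le p rho z m Hp Hz).
      assert (Hwm := Cmod_qshift_le p _ (z * z' / A)%C m Hp (Rle_refl _)).
      assert (R1 := Sser_rec p b A rho rho' _ z' Hp Hb HA Hr Hr' Hrr Hzm Hz').
      assert (R2 := gser_rec p b _ Hp Hb (Rle_lt_trans _ _ _ Hwm Hw)).
      replace (z * p ^ m * z' / A)%C with (z * z' / A * p ^ m)%C in R1
        by (unfold Cdiv; ring).
      replace (z * p ^ m * p)%C with (z * p ^ S m)%C in R1 by (simpl; ring).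
      replace (z * z' / A * p ^ m * p)%C with (z * z' / A * p ^ S m)%C in R2
        by (simpl; ring).
      assert (D := Cdenom_neq_0 p b (z * z' / A)%C m Hp Hb Hw).
      replace (z * z' / A * b * p ^ m)%C with (z * z' / A * p ^ m * b)%C in D by ring.
      revert R1 R2 IH D. generalize (z * z' / A * p ^ m)%C as w. intros w R1 R2 IH D.
      match goal with |- ?u = ?v =>
        assert (E : ((1 - w * b) * u = (1 - w * b) * v)%C) end.
      { transitivity (gser p b z * Sser p b A z z' *
          ((1 - w * b) * gser p b (z * z' / A * p ^ S m)))%C; [ring|].
        rewrite <- R2.
        transitivity ((1 - w) * (gser p b z * Sser p b A z z' * gser p b w))%C; [ring|].
        rewrite IH.
        transitivity ((1 - w) * (gser p b (z * p ^ m) * Sser p b A (z * p ^ m) z')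
          * gser p b (z * z' / A))%C; [ring|].
        rewrite R1. ring. }
      match goal with |- ?u = ?v =>
        transitivity ((1 - w * b) * u / (1 - w * b))%C; [field; exact D|];
        rewrite E; field; exact D end. }
  transitivity (gser p b z * Sser p b A z z' * 1)%C; [ring|].
  apply (C_filterlim_unique (fun m =>
    gser p b z * Sser p b A z z' * gser p b (z * z' / A * p ^ m))%C).
  - apply filterlim_Cmult; [apply filterlim_const|now apply gser_lim].
  - apply (filterlim_ext (fun m =>
      gser p b (z * p ^ m) * Sser p b A (z * p ^ m) z' * gser p b (z * z' / A))%C).
    { intros m. now rewrite It. }
    apply filterlim_Cmult; [|apply filterlim_const].
    now apply (Sser_lim_0 p b A rho rho').
Qed.

Lemma Rfac_eq_0 (p b A : R) (x m : nat) (z : C) : 0 < p < 1 -> 0 < A ->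
  (m < x)%nat -> z = (A * p ^ m)%C -> Rfac p b A x z = 0.
Proof.
  intros Hp HA Hm ->. apply (Cprod_eq_0 _ x m Hm).
  assert (HP := Cpow_RtoC_neq_0 p m (proj1 Hp)).
  assert (NA : RtoC A <> 0) by (apply RtoC_neq_0; lra).
  replace (1 - A * p ^ m / (A * p ^ m))%C with (RtoC 0) by (field; auto).
  unfold Cdiv. apply Cmult_0_l.
Qed.

Lemma six_phi_five (p b A rho rho' : R) (z z' : C) :
  0 < p < 1 -> 0 < b < 1 -> 0 < A < 1 -> 0 < rho < 1 -> 0 < rho' < 1 ->
  rho * rho' < A -> Cmod z <= rho -> Cmod z' <= rho' ->
  is_series (fun x => gser p b z * Rfac p b A x z * (gser p b z' * Rfac p b A x z')
                      * (RtoC (wr p b A x * Vt p b A x) / gser p b A))%C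
    (gser p b (z * z' / A)).
Proof.
  intros Hp Hb HA Hr Hr' Hrr Hz Hz'.
  assert (NA : RtoC A <> 0) by (apply RtoC_neq_0; lra).
  assert (GA : gser p b A <> 0).
  { rewrite gser_real by lra. apply RtoC_neq_0.
    destruct (qpoch_inf_correct A p Hp ltac:(lra)) as [_ H1].
    destruct (qpoch_inf_correct (A * b) p Hp ltac:(nra)) as [_ H2].
    apply Rgt_not_eq, Rdiv_lt_0_compat; lra. }
  assert (SA : Sser p b A A z' = 1).
  { apply CSeries_unique.
    assert (S0 : forall N, sum_n (Sterm p b A A z') N = RtoC 1).
    { induction N as [|N IH].
      - rewrite sum_O. unfold Sterm, Vt, hcoef, Rfac. simpl.
        replace (1 * (1 / 1 * (1 / 1) * 1)) with 1 by field. ring.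
      - rewrite sum_n_C_S, IH. unfold Sterm.
        rewrite (Rfac_eq_0 p b A (S N) 0 A); auto; try lia; try lra; [|simpl; ring].
        match goal with |- @eq _ ?u ?v => change (@eq C u v) end. ring. }
    apply (filterlim_ext (fun _ => RtoC 1)); [intros; now rewrite S0|].
    apply filterlim_const. }
  assert (E1 := Sser_via_0 p b A rho rho' z z' Hp Hb HA Hr Hr' Hrr Hz Hz').
  (* The point [A] is admissible with radius [A], as [A * rho' < A]. There [z z' / A] is [z'], so
     the unknown [Sser 0 z'] is determined by [gser A = Sser 0 z' * gser z']. *)
  assert (E2 := Sser_via_0 p b A A rho' A z' Hp Hb HA HA Hr' ltac:(nra)
                  ltac:(rewrite Cmod_pos_real; lra) Hz').
  rewrite SA in E2. replace (A * z' / A)%C with z' in E2 by (field; exact NA).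
  assert (S1 := Sser_series p b A rho rho' z z' Hp Hb HA Hr Hr' Hrr Hz Hz').
  apply (is_series_Cmult_l (gser p b z * gser p b z' / gser p b A)%C) in S1.
  replace (gser p b (z * z' / A))
    with (gser p b z * gser p b z' / gser p b A * Sser p b A z z')%C.
  - revert S1. apply is_series_C_ext. intros x. unfold Sterm. field. exact GA.
  - transitivity (gser p b z' / gser p b A * (gser p b z * Sser p b A z z'))%C;
      [field; exact GA|].
    rewrite E1.
    transitivity ((Sser p b A 0 z' * gser p b z') / gser p b A * gser p b (z * z' / A))%C;
      [field; exact GA|].
    rewrite <- E2. field. exact GA.
Qed.

(** * Orthogonality *)

(** Both sides sum one series, with [psi] expanded in powers or in closed form. At [z = A p^m] the
    left side is the inner product of [psi] with [X^m] for the mass [A^n h_n] at [X = p^n]. *)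
Lemma gser_psi_sum (p b A : R) (y : nat) (z : C) :
  0 < p < 1 -> 0 < b < 1 -> 0 < A -> Cmod z < 1 ->
  (sum_n (fun m => pcoef p b A y m * gser p b (z * p ^ m)) y
   = gser p b z * Rfac p b A y z)%C.
Proof.
  intros Hp Hb HA Hz.
  apply (is_series_C_unique (fun n => z ^ n * (hcoef p b n * psi p b A y (p ^ n))%R)%C).
  2: now apply psi_series.
  apply (is_series_C_ext (fun n => sum_n (fun m => pcoef p b A y m *
    ((z * p ^ m) ^ n * hcoef p b n))%C y)).
  - intros n. rewrite psi_expand, RtoC_mult, sum_n_RtoC.
    rewrite Cmult_assoc, <- sum_n_C_mult. apply sum_n_C_ext. intros m _.
    rewrite Cpow_mult_l, RtoC_mult, !RtoC_pow, <- !Cpow_mult_r.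
    rewrite (Nat.mul_comm m n). ring.
  - apply is_series_C_sum_n. intros m. apply is_series_Cmult_l, gser_series; auto.
    eapply Rle_lt_trans; [apply (Cmod_qshift_le p (Cmod z)); auto; lra|exact Hz].
Qed.

(** Only the polynomial attached to [B] is expanded: [x] is to be summed over, so its dependence is
    kept in the closed form [Rfac]. *)
Definition Pval (p b A B : R) (z : C) (x y : nat) : C :=
  sum_n (fun m => pcoef p b B y m
    * (gser p b (z * p ^ m) * Rfac p b A x (z * p ^ m)))%C y.

Lemma Pval_series (p b A B : R) (z : C) (x y : nat) :
  0 < p < 1 -> 0 < b < 1 -> 0 < A -> Cmod z < 1 ->
  is_series (fun n => z ^ n * (hcoef p b n * psi p b A x (p ^ n) * psi p b B y (p ^ n))%R)%C
    (Pval p b A B z x y).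
Proof.
  intros Hp Hb HA Hz.
  apply (is_series_C_ext (fun n => sum_n (fun m => pcoef p b B y m *
    ((z * p ^ m) ^ n * (hcoef p b n * psi p b A x (p ^ n))%R))%C y)).
  - intros n. rewrite (psi_expand p b B).
    rewrite (RtoC_mult (hcoef p b n * psi p b A x (p ^ n))), sum_n_RtoC.
    rewrite Cmult_assoc, <- sum_n_C_mult. apply sum_n_C_ext. intros m _.
    rewrite Cpow_mult_l, !RtoC_mult, !RtoC_pow, <- !Cpow_mult_r.
    rewrite (Nat.mul_comm m n). ring.
  - apply is_series_C_sum_n. intros m. apply is_series_Cmult_l, psi_series; auto.
    eapply Rle_lt_trans; [apply (Cmod_qshift_le p (Cmod z)); auto; lra|exact Hz].
Qed.

(* [W q k x s] at [p = q^2], [b = q^(2k)], [A = q^(2s+2)]. *)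
Definition Wp (p b A : R) (x : nat) : R :=
  wr p b A x * Vt p b A x * (qpoch_inf A p / qpoch_inf (A * b) p).

Lemma Wp_gser (p b A : R) (x : nat) :
  0 < p < 1 -> 0 < b < 1 -> 0 < A < 1 ->
  RtoC (Wp p b A x) = (RtoC (wr p b A x * Vt p b A x) / gser p b A)%C.
Proof.
  intros Hp Hb HA.
  destruct (qpoch_inf_correct A p Hp ltac:(lra)) as [_ H1].
  destruct (qpoch_inf_correct (A * b) p Hp ltac:(nra)) as [_ H2].
  rewrite gser_real by lra. unfold Wp.
  rewrite (RtoC_mult (wr p b A x * Vt p b A x)), !RtoC_div by lra.
  field. split; apply RtoC_neq_0; lra.
Qed.

Lemma Cprod_telescope (f : nat -> C) (n : nat) :
  (forall i, f i <> 0) -> Cprod (fun i => f i / f (S i))%C n = (f 0%nat / f n)%C.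
Proof.
  intros H. induction n as [|n IH]; simpl; [field; apply H|].
  rewrite IH. field. split; apply H.
Qed.

Lemma Cminus_1_inv_neq_0 (c X : C) :
  c <> 0 -> X <> 0 -> (1 - c * X)%C <> 0 -> (1 - / c / X)%C <> 0.
Proof.
  intros Hc HX H E. apply H.
  replace (1 - c * X)%C with (- (c * X) * (1 - / c / X))%C by (field; auto).
  rewrite E. ring.
Qed.

Lemma kap_pos (p A : R) (x : nat) : 0 < p -> 0 < A -> 0 < kap p A x.
Proof.
  intros Hp HA. induction x as [|x IH]; simpl; [lra|].
  assert (P := pow_lt p x Hp).
  repeat apply Rmult_lt_0_compat; auto.
Qed.

(** This yields the squared norm of [psi]. Every ingredient except [wr] is a product over [i < y],
    but the factors match only after some of the products are reversed. *)
Lemma pcoef_diagonal (p b A : R) (y : nat) :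
  0 < p < 1 -> 0 < b < 1 -> 0 < A < 1 ->
  (pcoef p b A y y * Rfac p b A y (A * p ^ y)
   * RtoC (wr p b A y * hcoef p b y * kap p A y) = 1)%C.
Proof.
  intros Hp Hb HA.
  assert (HP := fun n => Cpow_RtoC_neq_0 p n (proj1 Hp)).
  assert (Np : RtoC p <> 0) by (apply RtoC_neq_0; lra).
  assert (Nb : RtoC b <> 0) by (apply RtoC_neq_0; lra).
  assert (NA : RtoC A <> 0) by (apply RtoC_neq_0; lra).
  assert (F1 : forall n, (1 - b * p ^ n)%C <> 0).
  { intros n. rewrite <- RtoC_pow, <- RtoC_mult, <- RtoC_minus.
    apply RtoC_neq_0. assert (H := qpoch_factor_pos b p n Hp ltac:(lra)). lra. }
  assert (F2 : forall n, (1 - p * p ^ n)%C <> 0).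
  { intros n. rewrite <- RtoC_pow, <- RtoC_mult, <- RtoC_minus.
    apply RtoC_neq_0. assert (H := qpoch_factor_pos p p n Hp ltac:(lra)). lra. }
  assert (F3 : forall n, (1 - A * b * p ^ n)%C <> 0).
  { intros n. rewrite <- RtoC_pow, <- !RtoC_mult, <- RtoC_minus.
    apply RtoC_neq_0. assert (H := qpoch_factor_pos (A * b) p n Hp ltac:(nra)). lra. }
  destruct y as [|k].
  { unfold pcoef, vcoef, Rfac, hcoef. rewrite sum_O. simpl.
    rewrite Cmult_1_r, <- RtoC_mult. f_equal. field. }
  assert (K : RtoC (kap p A (S k)) = Cprod (fun i => A * (p ^ i * p ^ i))%C (S k)).
  { induction (S k) as [|n IH]; [reflexivity|].
    simpl. rewrite <- IH, !RtoC_mult, !RtoC_pow. reflexivity. }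
  (* The very-well-poised factor comes from a telescoping product, with value
     [(1 - A b p^k) / (1 - A b p^(2k+1))]. *)
  assert (T : (Cprod (fun i => (1 - A * b * p ^ (k + i)) / (1 - A * b * p ^ (k + S i))) (S k)
               * RtoC (wr p b A (S k)) = 1)%C).
  { rewrite (Cprod_telescope (fun i => 1 - A * b * p ^ (k + i)))%C by (intros; apply F3).
    simpl wr. rewrite Nat.add_0_r. assert (Fk := F3 k). assert (Fk2 := F3 (k + S k)%nat).
    rewrite RtoC_div.
    2:{ assert (H := qpoch_factor_pos (A * b) p k Hp ltac:(nra)). lra. }
    rewrite !RtoC_minus, !RtoC_mult, !RtoC_pow.
    rewrite Cpow_add_r in *. simpl in *.
    replace (A * b * p * (p ^ k * p ^ k))%C with (A * b * (p ^ k * (p * p ^ k)))%C by ring.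
    field. auto. }
  (* [V] and [U] divide a product by itself in another order. *)
  assert (V : Cprod (fun i => p ^ i / p ^ (S k - S i))%C (S k) = 1).
  { rewrite Cprod_div by (intros; apply HP).
    assert (Rv := Cprod_rev (fun i => p ^ i)%C (S k)). cbv beta in Rv.
    rewrite Rv. apply Cinv_r.
    apply Cprod_neq_0; intros; apply HP. }
  assert (U : Cprod (fun i => (1 - p ^ S (S k - S i)) / (1 - p ^ S i))%C (S k) = 1).
  { rewrite Cprod_div by (intros; simpl; apply F2).
    assert (Rv := Cprod_rev (fun i => 1 - p ^ S i)%C (S k)). cbv beta in Rv.
    rewrite Rv. apply Cinv_r.
    apply Cprod_neq_0; intros; simpl; apply F2. }
  rewrite pcoef_lead, RtoC_mult, qcoef_lead. unfold vcoef, Rfac, hcoef.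
  assert (N1 := qpoch_inv_neq_0 (/ b) p (S k) Hp (Rinv_gt_1 b Hb)).
  assert (N2 := qpoch_inv_neq_0 (/ p) p (S k) Hp (Rinv_gt_1 p Hp)).
  assert (N3 := qpoch_bounds p p (S k) Hp ltac:(lra)).
  rewrite RtoC_mult, RtoC_div by (now apply Rmult_integral_contrapositive_currified).
  rewrite !RtoC_mult. rewrite (RtoC_div (qpoch b p (S k))) by lra.
  rewrite K.
  apply RtoC_neq_0 in N1. apply RtoC_neq_0 in N2.
  assert (N4 : RtoC (qpoch p p (S k)) <> 0) by (apply RtoC_neq_0; lra).
  rewrite !RtoC_qpoch_inv in * by lra.
  rewrite !(RtoC_qpoch _ p) in *.
  rewrite (RtoC_pow (/ p)), !RtoC_inv in * by lra.
  rewrite <- (Cprod_const (/ p)%C).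
  assert (Pk := pow_lt p (S k) (proj1 Hp)).
  rewrite (RtoC_div p), !RtoC_mult, !(RtoC_pow p (S k)).
  2:{ apply Rgt_not_eq, Rmult_lt_0_compat; [apply Rmult_lt_0_compat; lra|exact Pk]. }
  set (P := (RtoC p ^ S k)%C) in *.
  set (a1 := fun i => (1 - P / p ^ i)%C) in *.
  set (a2 := fun i => (1 - p / (A * b * P) / p ^ i)%C) in *.
  set (a3 := fun i => (1 - / b / p ^ i)%C) in *.
  set (a4 := fun i => (1 - / p / p ^ i)%C) in *.
  set (a6 := fun i => (- (/ p) ^ i)%C) in *.
  set (a7 := fun i => (1 - p * p ^ i)%C) in *.
  set (a8 := fun i => (1 - b * p ^ i)%C) in *.
  set (a10 := fun i => (A * (p ^ i * p ^ i))%C) in *.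
  set (rf := fun i => ((1 - A * P / (A * p ^ i)) / (1 - A * P * b * p ^ i))%C) in *.
  transitivity (Cprod (fun i => (a1 i * a2 i * / p * a6 i * rf i * a8 i * a10 i)
                          / (a3 i * a4 i * a7 i))%C (S k) * wr p b A (S k))%C.
  - rewrite Cprod_div.
    + rewrite !Cprod_mult. field. repeat split; auto.
    + intros i _. repeat apply Cmult_neq_0; unfold a3, a4, a7; auto;
        apply Cminus_1_inv_neq_0; auto.
  (* The [i]-th factor splits into the quotients of [V], [U] (twice) and [T]. *)
  - rewrite (Cprod_ext _ (fun i => (p ^ i / p ^ (S k - S i))
      * (((1 - p ^ S (S k - S i)) / (1 - p ^ S i))
         * ((1 - p ^ S (S k - S i)) / (1 - p ^ S i)))
      * ((1 - A * b * p ^ (k + i)) / (1 - A * b * p ^ (k + S i))))%C).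
    + rewrite !Cprod_mult, V, U, !Cmult_1_l. exact T.
    + intros i Hi. unfold a1, a2, a3, a4, a6, a7, a8, a10, rf, P.
      assert (Ek : (RtoC p ^ k = p ^ (k - i) * p ^ i)%C)
        by (rewrite <- Cpow_add_r; f_equal; lia).
      assert (G1 := F1 i). assert (G2 := F2 i). assert (G3 := F3 (k + S i)%nat).
      assert (H1 := HP i). assert (H2 := HP (k - i)%nat).
      rewrite !Cpow_add_r in *.
      replace (S k - S i)%nat with (k - i)%nat by lia.
      rewrite Cpow_inv by auto. simpl Cpow in *. rewrite Ek in *.
      revert G1 G2 G3 H1 H2.
      generalize (RtoC p ^ i)%C, (RtoC p ^ (k - i))%C. intros X u G1 G2 G3 H1 H2.
      assert (G1' : (b * X - 1)%C <> 0).
      { intros E. apply G1. replace (1 - b * X)%C with (- (b * X - 1))%C by ring.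
        rewrite E. ring. }
      assert (G2' : (p * X - 1)%C <> 0).
      { intros E. apply G2. replace (1 - p * X)%C with (- (p * X - 1))%C by ring.
        rewrite E. ring. }
      assert (G3' : (1 - A * (p * (u * X)) * b * X)%C <> 0).
      { intros E. apply G3. rewrite <- E. ring. }
      field. repeat split; auto.
Qed.

(** As [m <= y < y'], each inner sum is evaluated at a zero [A p^m] of [Rfac y']. *)
Lemma finite_orthogonality_lt (p b A : R) (y y' : nat) :
  0 < p < 1 -> 0 < b < 1 -> 0 < A < 1 -> (y < y')%nat ->
  sum_n (fun m => pcoef p b A y m * sum_n (fun m' =>
    pcoef p b A y' m' * gser p b (A * p ^ m * p ^ m')) y')%C y = RtoC 0.
Proof.
  intros Hp Hb HA Hy.
  rewrite (sum_n_C_ext _ (fun m => 0 * RtoC (pcoef p b A y m)))%C.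
  - rewrite sum_n_C_mult. apply Cmult_0_l.
  - intros m Hm. rewrite gser_psi_sum; auto; try lra.
    + rewrite (Rfac_eq_0 p b A y' m (A * p ^ m)%C); auto; try lia; try lra. ring.
    + eapply Rle_lt_trans; [apply (Cmod_qshift_le p A); auto|lra].
      rewrite Cmod_pos_real; lra.
Qed.

Lemma finite_orthogonality (p b A : R) (y y' : nat) :
  0 < p < 1 -> 0 < b < 1 -> 0 < A < 1 ->
  sum_n (fun m => pcoef p b A y m * sum_n (fun m' =>
    pcoef p b A y' m' * gser p b (A * p ^ m * p ^ m')) y')%C y
  = RtoC (delta y y' / Wp p b A y).
Proof.
  intros Hp Hb HA. unfold delta.
  destruct (Nat.eqb_spec y y') as [<-|Hne].
  - assert (HAm : forall m, Cmod (A * p ^ m) < 1).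
    { intros m. eapply Rle_lt_trans; [apply (Cmod_qshift_le p A); auto|lra].
      rewrite Cmod_pos_real; lra. }
    (* The inner sums with [m < y] still vanish, so only the leading coefficient [m = y]
       contributes. *)
    transitivity (pcoef p b A y y * (gser p b (A * p ^ y) * Rfac p b A y (A * p ^ y)))%C.
    + assert (E : forall m, (m < y)%nat -> (pcoef p b A y m * sum_n (fun m' =>
        pcoef p b A y m' * gser p b (A * p ^ m * p ^ m')) y)%C = 0).
      { intros m Hm. rewrite gser_psi_sum; auto; try lra.
        rewrite (Rfac_eq_0 p b A y m (A * p ^ m)%C); auto; try lra. ring. }
      rewrite <- gser_psi_sum; auto; try lra. revert E.
      set (F := fun m => (pcoef p b A y m * sum_n (fun m' =>
        pcoef p b A y m' * gser p b (A * p ^ m * p ^ m')) y)%C).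
      intros E. change (forall m, (m < y)%nat -> F m = 0) in E.
      change (sum_n F y = F y).
      clearbody F. destruct y as [|n]; [apply sum_O|].
      rewrite sum_n_C_S, (sum_n_C_ext _ (fun m => 0 * 0)%C).
      * rewrite sum_n_C_mult, Cmult_0_l. apply Cplus_0_l.
      * intros m Hm. rewrite E by lia. ring.
    (* Relating [gser (A p^y)] to [gser A] produces [(A; p)_y / (A b; p)_y], the part of [1 / Wp]
       that [pcoef_diagonal] does not contain. *)
    + assert (It := gser_iter p b A y Hp Hb ltac:(rewrite Cmod_pos_real; lra)).
      assert (D := pcoef_diagonal p b A y Hp Hb HA).
      assert (HQ1 := qpoch_bounds A p y Hp ltac:(lra)).
      assert (HQ2 := qpoch_bounds (A * b) p y Hp ltac:(nra)).
      destruct (qpoch_inf_correct A p Hp ltac:(lra)) as [_ H1].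
      destruct (qpoch_inf_correct (A * b) p Hp ltac:(nra)) as [_ H2].
      assert (W0 := wr_bound p b A y Hp Hb HA).
      assert (h0 := hcoef_pos p b y Hp Hb).
      assert (k0 := kap_pos p A y (proj1 Hp) (proj1 HA)).
      rewrite <- RtoC_mult, <- !RtoC_qpoch in It.
      rewrite gser_real in It by lra.
      assert (E : gser p b (A * p ^ y)
        = RtoC (qpoch A p y / qpoch (A * b) p y * (qpoch_inf (A * b) p / qpoch_inf A p))).
      { rewrite RtoC_mult, (RtoC_div (qpoch A p y)) by lra.
        assert (N : RtoC (qpoch (A * b) p y) <> 0) by (apply RtoC_neq_0; lra).
        transitivity (RtoC (qpoch (A * b) p y) * gser p b (A * p ^ y)
          / RtoC (qpoch (A * b) p y))%C; [field; exact N|].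
        rewrite <- It. field. exact N. }
      rewrite E.
      transitivity (RtoC (/ Wp p b A y) * (pcoef p b A y y * Rfac p b A y (A * p ^ y)
         * RtoC (wr p b A y * hcoef p b y * kap p A y)))%C.
      * rewrite !Cmult_assoc.
        match goal with |- (?a * RtoC ?r * ?c = RtoC ?s * ?a * ?c * RtoC ?u)%C =>
          replace r with (s * u) end.
        { rewrite (RtoC_mult (/ Wp p b A y)).
          match goal with |- @eq _ ?u ?v => change (@eq C u v) end. ring. }
        unfold Wp, Vt. field. repeat split; lra.
      * rewrite D, Cmult_1_r. f_equal. unfold Rdiv. ring.
  - transitivity (RtoC 0); [|f_equal; unfold Rdiv; ring].
    destruct (Nat.lt_trichotomy y y') as [H|[H|H]]; [|easy|].
    + now apply finite_orthogonality_lt.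
    (* The kernel is symmetric in [m] and [m'], so exchanging the finite sums swaps [y] and [y']. *)
    + rewrite <- (finite_orthogonality_lt p b A y' y Hp Hb HA H).
      rewrite (sum_n_C_ext _ (fun m => sum_n (fun m' => pcoef p b A y m
        * (pcoef p b A y' m' * gser p b (A * p ^ m * p ^ m')))%C y')).
      2:{ intros m _. now rewrite <- sum_n_C_mult. }
      rewrite sum_n_switch. apply sum_n_C_ext. intros m _.
      rewrite <- sum_n_C_mult. apply sum_n_C_ext. intros m' _.
      replace (A * p ^ m' * p ^ m)%C with (A * p ^ m * p ^ m')%C by ring. ring.
Qed.

Lemma P_orthogonality (p b A B rho rho' : R) (z z' : C) (y y' : nat) :
  0 < p < 1 -> 0 < b < 1 -> 0 < A < 1 -> 0 < B < 1 ->
  0 < rho < 1 -> 0 < rho' < 1 ->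
  rho * rho' < A -> Cmod z <= rho -> Cmod z' <= rho' -> (z * z' = A * B)%C ->
  is_series (fun x => Pval p b A B z x y * Pval p b A B z' x y' * Wp p b A x)%C
    (RtoC (delta y y' / Wp p b B y)).
Proof.
  intros Hp Hb HA HB Hr Hr' Hrr Hz Hz' Hzz.
  assert (NA : RtoC A <> 0) by (apply RtoC_neq_0; lra).
  rewrite <- finite_orthogonality by auto.
  apply (is_series_C_ext (fun x => sum_n (fun m => pcoef p b B y m * sum_n (fun m' =>
    pcoef p b B y' m' *
     (gser p b (z * p ^ m) * Rfac p b A x (z * p ^ m)
      * (gser p b (z' * p ^ m') * Rfac p b A x (z' * p ^ m'))
      * (RtoC (wr p b A x * Vt p b A x) / gser p b A))) y')%C y)).
  - intros x. rewrite Wp_gser by auto. unfold Pval.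
    set (w := (RtoC (wr p b A x * Vt p b A x) / gser p b A)%C).
    set (F := fun m => (pcoef p b B y m
      * (gser p b (z * p ^ m) * Rfac p b A x (z * p ^ m)))%C).
    set (F' := fun m => (pcoef p b B y' m
      * (gser p b (z' * p ^ m) * Rfac p b A x (z' * p ^ m)))%C).
    rewrite (sum_n_C_ext _ (fun m => (sum_n F' y' * w) * F m)%C).
    + rewrite sum_n_C_mult.
      match goal with |- @eq _ ?u ?v => change (@eq C u v) end. ring.
    + intros m _.
      rewrite (sum_n_C_ext _ (fun m' => (gser p b (z * p ^ m)
        * Rfac p b A x (z * p ^ m) * w) * F' m')%C).
      * rewrite sum_n_C_mult. unfold F.
        match goal with |- @eq _ ?u ?v => change (@eq C u v) end. ring.
      * intros m' _. unfold F'. ring.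
  - apply is_series_C_sum_n. intros m. apply is_series_Cmult_l.
    apply is_series_C_sum_n. intros m'. apply is_series_Cmult_l.
    replace (B * p ^ m * p ^ m')%C with (z * p ^ m * (z' * p ^ m') / A)%C.
    + apply (six_phi_five p b A rho rho'); auto; now apply Cmod_qshift_le.
    + transitivity (z * z' * p ^ m * p ^ m' / A)%C; [field; exact NA|].
      rewrite Hzz. field. exact NA.
Qed.

(** * The statement in terms of [q], [k], [s], [t] *)

Lemma Cexp_plus (z1 z2 : C) : Cexp (z1 + z2) = (Cexp z1 * Cexp z2)%C.
Proof.
  destruct z1 as [a1 b1], z2 as [a2 b2]. unfold Cexp, Cmult, Cplus. simpl.
  rewrite exp_plus, cos_plus, sin_plus. f_equal; ring.
Qed.

Lemma Cqpow_plus (q : R) (z1 z2 : C) :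
  Cqpow q (z1 + z2) = (Cqpow q z1 * Cqpow q z2)%C.
Proof. unfold Cqpow. rewrite <- Cexp_plus. f_equal. ring. Qed.

Lemma Cqpow_RtoC (q r : R) : Cqpow q (RtoC r) = RtoC (Rpower q r).
Proof.
  unfold Cqpow, Rpower. rewrite <- RtoC_mult. unfold Cexp, RtoC. simpl.
  rewrite cos_0, sin_0. f_equal; ring.
Qed.

Lemma Cqpow_nat (q : R) (z : C) (n : nat) :
  Cqpow q (RtoC (INR n) * z) = (Cqpow q z ^ n)%C.
Proof.
  induction n as [|n IH].
  - simpl. rewrite Cmult_0_l, Cqpow_RtoC. unfold Rpower.
    now rewrite Rmult_0_l, exp_0.
  - rewrite S_INR, RtoC_plus. cbn [Cpow]. rewrite <- IH, <- Cqpow_plus. f_equal. ring.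
Qed.

Lemma Cmod_Cqpow (q : R) (z : C) : Cmod (Cqpow q z) = Rpower q (Re z).
Proof.
  unfold Cqpow, Cexp, Rpower. destruct z as [x y].
  set (E := exp (Re ((x, y) * RtoC (ln q))%C)).
  set (th := Im ((x, y) * RtoC (ln q))%C).
  unfold Cmod. simpl.
  replace (E * cos th * (E * cos th * 1) + E * sin th * (E * sin th * 1)) with (E²).
  - rewrite sqrt_Rsqr by (left; apply exp_pos). unfold E. f_equal. simpl. ring.
  - assert (T := sin2_cos2 th). unfold Rsqr in *.
    replace (E * cos th * (E * cos th * 1) + E * sin th * (E * sin th * 1))
      with (E * E * (sin th * sin th + cos th * cos th)) by ring.
    rewrite T. ring.
Qed.

Lemma Cconj_Cqpow (q : R) (z : C) : Cconj (Cqpow q z) = Cqpow q (Cconj z).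
Proof.
  unfold Cqpow, Cexp, Cconj. destruct z as [x y]. simpl.
  replace (x * ln q - - y * 0) with (x * ln q - y * 0) by ring.
  replace (x * 0 + - y * ln q) with (- (x * 0 + y * ln q)) by ring.
  rewrite cos_neg, sin_neg. f_equal. ring.
Qed.

Lemma Rpower_mult_nat (q r : R) (n : nat) : Rpower q (r * INR n) = Rpower q r ^ n.
Proof. rewrite <- Rpower_mult. apply Rpower_pow. apply exp_pos. Qed.

Lemma Rpower_bounds (q r : R) : 0 < q < 1 -> 0 < r -> 0 < Rpower q r < 1.
Proof.
  intros Hq Hr. split; [apply exp_pos|]. unfold Rpower. rewrite <- exp_0.
  apply exp_increasing. assert (ln q < 0) by (rewrite <- ln_1; apply ln_increasing; lra).
  nra.
Qed.

(** [phi_sum] stops at [min n x], while [psi] runs to [x] so as to be one polynomial for all [n].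
    The terms with [n < j] vanish, since [(p^n; 1/p)_j] then contains the factor [1 - p^n / p^n]. *)
Lemma phi_sum_psi (q k s : R) (n x : nat) : 0 < q < 1 ->
  phi_sum q k s n x
  = psi (Rpower q 2) (Rpower q (2 * k)) (Rpower q (2 * s + 2)) x (Rpower q 2 ^ n).
Proof.
  intros Hq. unfold phi_sum, psi.
  assert (P2 : 0 < Rpower q 2 < 1) by (apply Rpower_bounds; lra).
  transitivity (sum_n (fun j => vcoef (Rpower q 2) (Rpower q (2 * k))
    (Rpower q (2 * s + 2)) x j * qpoch (Rpower q 2 ^ n) (/ Rpower q 2) j) (Nat.min n x)).
  - apply sum_n_ext. intros j. unfold vcoef, qpochs. cbn [fold_right].
    replace (Rpower q (2 * INR n)) with (Rpower q 2 ^ n)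
      by (now rewrite <- Rpower_mult_nat).
    replace (Rpower q (2 * INR x)) with (Rpower q 2 ^ x)
      by (now rewrite <- Rpower_mult_nat).
    replace (Rpower q (- 2)) with (/ Rpower q 2) by (rewrite <- Rpower_Ropp; f_equal; lra).
    replace (Rpower q (- 2 * k)) with (/ Rpower q (2 * k))
      by (rewrite <- Rpower_Ropp; f_equal; lra).
    replace (Rpower q (- 2 * INR j)) with ((/ Rpower q 2) ^ j)
      by (rewrite <- Rpower_Ropp, <- Rpower_mult_nat; f_equal; lra).
    replace (Rpower q (- 2 * INR x - 2 * s - 2 * k)) with
      (Rpower q 2 / (Rpower q (2 * s + 2) * Rpower q (2 * k) * Rpower q 2 ^ x)).
    2:{ rewrite <- Rpower_mult_nat, <- !Rpower_plus. unfold Rdiv.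
        rewrite <- Rpower_Ropp, <- Rpower_plus. f_equal. lra. }
    unfold Rdiv. rewrite !Rmult_1_r.
    match goal with |- @eq _ ?u ?v => change (@eq R u v) end. ring.
  - assert (Z : forall j, (n < j)%nat -> qpoch (Rpower q 2 ^ n) (/ Rpower q 2) j = 0).
    { intros j Hj. apply RtoC_inj. rewrite RtoC_qpoch_inv, RtoC_pow by lra.
      apply (Cprod_eq_0 _ j n Hj).
      assert (N := Cpow_RtoC_neq_0 (Rpower q 2) n (proj1 P2)). field. exact N. }
    destruct (Nat.le_gt_cases x n) as [H|H]; [now rewrite Nat.min_r|].
    rewrite Nat.min_l by lia.
    match goal with |- sum_n ?F _ = _ =>
      assert (Q : forall d, sum_n F n = sum_n F (n + d)%nat) end.
    { induction d as [|d IH]; [now rewrite Nat.add_0_r|].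
      rewrite Nat.add_succ_r, sum_n_R_S, <- IH, Z by lia.
      rewrite Rmult_0_r. symmetry. apply Rplus_0_r. }
    rewrite (Q (x - n)%nat). f_equal. lia.
Qed.

(** The exponents [s - 1 + k/2 + 1/2], [t - v + k/2 + 1/2] and [1 - k] add up to [s + t + 1 - v];
    the asymmetry between [u = 1] and [u = v] disappears. *)
Lemma P_r_series (q k s t : R) (v : C) (x y : nat) : 0 < q < 1 ->
  P_r q k x y s t v = CSeries (fun n => Cqpow q (RtoC (s + t + 1) - v) ^ n *
    (hcoef (Rpower q 2) (Rpower q (2 * k)) n
     * psi (Rpower q 2) (Rpower q (2 * k)) (Rpower q (2 * s + 2)) x (Rpower q 2 ^ n)
     * psi (Rpower q 2) (Rpower q (2 * k)) (Rpower q (2 * t + 2)) y (Rpower q 2 ^ n))%R)%C.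
Proof.
  intros Hq. unfold P_r.
  assert (E : forall n, (phi q k (RtoC 1) s n x * phi q k v t n y * RtoC (w q k n))%C =
    (Cqpow q (RtoC (s + t + 1) - v) ^ n *
    (hcoef (Rpower q 2) (Rpower q (2 * k)) n
     * psi (Rpower q 2) (Rpower q (2 * k)) (Rpower q (2 * s + 2)) x (Rpower q 2 ^ n)
     * psi (Rpower q 2) (Rpower q (2 * k)) (Rpower q (2 * t + 2)) y (Rpower q 2 ^ n))%R)%C).
  { intros n. unfold phi, w. rewrite !phi_sum_psi by exact Hq.
    rewrite <- Cqpow_nat.
    replace (RtoC (INR n) * (RtoC (s + t + 1) - v))%C with
      (RtoC (INR n) * (RtoC s - RtoC 1 + RtoC (k / 2)%R + RtoC (1 / 2)%R)
       + RtoC (INR n) * (RtoC t - v + RtoC (k / 2)%R + RtoC (1 / 2)%R)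
       + RtoC (- INR n * (k - 1)))%C.
    - rewrite !Cqpow_plus, Cqpow_RtoC. fold (hcoef (Rpower q 2) (Rpower q (2 * k)) n).
      rewrite !RtoC_mult. ring.
    - replace (k / 2) with ((k - 1) / 2 + 1 / 2) by field.
      replace (- INR n * (k - 1)) with (- (INR n * ((k - 1) / 2 + (k - 1) / 2))) by field.
      replace (s + t + 1) with (s + t - 1 + (1 / 2 + 1 / 2 + 1 / 2 + 1 / 2)) by field.
      rewrite !RtoC_opp, !RtoC_mult, !RtoC_plus, !RtoC_minus, !RtoC_plus. ring. }
  unfold CSeries. f_equal; apply Series_ext; intros n; now rewrite E.
Qed.

Lemma qpoch_inf_iter (a p : R) (n : nat) : 0 < p < 1 -> 0 <= a < 1 ->
  qpoch_inf a p = qpoch a p n * qpoch_inf (a * p ^ n) p.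
Proof.
  intros Hp Ha. induction n as [|n IH]; [simpl; rewrite Rmult_1_r; ring|].
  assert (P := Rpow_le_1 p n Hp).
  rewrite IH, (qpoch_inf_shift (a * p ^ n)) by nra. simpl.
  rewrite <- Rmult_assoc. f_equal. f_equal. ring.
Qed.

Lemma kap_Rpower (q s : R) (x : nat) :
  kap (Rpower q 2) (Rpower q (2 * s + 2)) x = Rpower q (2 * INR x * (INR x + s)).
Proof.
  induction x as [|x IH].
  - simpl. unfold Rpower. rewrite Rmult_0_r, !Rmult_0_l, exp_0. reflexivity.
  - rewrite S_INR. simpl kap. rewrite IH, <- Rpower_mult_nat, <- !Rpower_plus.
    f_equal. ring.
Qed.

(** The infinite products of [W] start at [A p^x] and [A b p^x]. Pulled back to [A] and [A b], they
    leave a constant and the quotient [(A b; p)_x / (A; p)_x] in [Vt]. *)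
Lemma W_Wp (q k s : R) (x : nat) : 0 < q < 1 -> 0 < k -> -1 < s ->
  W q k x s = Wp (Rpower q 2) (Rpower q (2 * k)) (Rpower q (2 * s + 2)) x.
Proof.
  intros Hq Hk Hs. unfold W, Wp, Vt. rewrite <- kap_Rpower.
  assert (Ep := Rpower_bounds q 2 Hq ltac:(lra)).
  assert (Eb := Rpower_bounds q (2 * k) Hq ltac:(lra)).
  assert (EA := Rpower_bounds q (2 * s + 2) Hq ltac:(lra)).
  assert (Wr : W_ratio q k x s
    = wr (Rpower q 2) (Rpower q (2 * k)) (Rpower q (2 * s + 2)) x).
  { destruct x as [|x]; [reflexivity|]. unfold W_ratio, wr.
    rewrite S_INR, <- Rpower_mult_nat, <- !Rpower_plus.
    replace (2 * s + 2 + 2 * k + 2 + (2 * INR x + 2 * INR x))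
      with (4 * (INR x + 1) + 2 * s + 2 * k) by ring.
    replace (2 * s + 2 + 2 * k + 2 * INR x)
      with (2 * (INR x + 1) + 2 * s + 2 * k) by ring.
    reflexivity. }
  rewrite Wr. clear Wr.
  replace (Rpower q (2 * INR x + 2 * s + 2)) with (Rpower q (2 * s + 2) * Rpower q 2 ^ x)
    by (rewrite <- Rpower_mult_nat, <- Rpower_plus; f_equal; ring).
  replace (Rpower q (2 * INR x + 2 * s + 2 * k + 2))
    with (Rpower q (2 * s + 2) * Rpower q (2 * k) * Rpower q 2 ^ x)
    by (rewrite <- Rpower_mult_nat, <- !Rpower_plus; f_equal; ring).
  fold (hcoef (Rpower q 2) (Rpower q (2 * k)) x).
  revert Ep Eb EA.
  generalize (Rpower q 2), (Rpower q (2 * k)), (Rpower q (2 * s + 2)).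
  intros p b A Hp Hb HA.
  assert (0 <= A * b < 1) by nra.
  assert (P := Rpow_le_1 p x Hp).
  rewrite (qpoch_inf_iter A p x), (qpoch_inf_iter (A * b) p x) by lra.
  assert (H1 := qpoch_bounds A p x Hp ltac:(lra)).
  assert (H2 := qpoch_bounds (A * b) p x Hp ltac:(lra)).
  destruct (qpoch_inf_correct (A * b * p ^ x) p Hp ltac:(nra)) as [_ H3].
  field. lra.
Qed.

Lemma P_r_orthogonality (q k s t : R) (v : C) (y y' : nat) :
  0 < q < 1 -> 0 < k -> -1 < s -> -1 < t -> Rabs (Re v + 1) < 2 + s + t ->
  is_series (fun x => P_r q k x y s t v
     * Cconj (P_r q k x y' s t (- Cconj v - RtoC 2)) * RtoC (W q k x s))%C
    (RtoC (delta y y' / W q k y t)).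
Proof.
  intros Hq Hk Hs Ht Hv. apply Rabs_lt_between in Hv.
  assert (Ep := Rpower_bounds q 2 Hq ltac:(lra)).
  assert (Eb := Rpower_bounds q (2 * k) Hq ltac:(lra)).
  assert (EA := Rpower_bounds q (2 * s + 2) Hq ltac:(lra)).
  assert (EB := Rpower_bounds q (2 * t + 2) Hq ltac:(lra)).
  set (z := Cqpow q (RtoC (s + t + 1) - v)%C).
  (* Conjugating [s + t + 1 - (- conj v - 2)] gives [s + t + 3 + v], so [v] cancels in [z * z']. *)
  set (z' := Cqpow q (RtoC (s + t + 3) + v)%C).
  assert (Mz : Cmod z = Rpower q (s + t + 1 - Re v)) by apply Cmod_Cqpow.
  assert (Mz' : Cmod z' = Rpower q (s + t + 3 + Re v)) by apply Cmod_Cqpow.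
  assert (Lz := Rpower_bounds q (s + t + 1 - Re v) Hq ltac:(lra)).
  assert (Lz' := Rpower_bounds q (s + t + 3 + Re v) Hq ltac:(lra)).
  rewrite <- Mz in Lz. rewrite <- Mz' in Lz'.
  rewrite (W_Wp q k t) by auto.
  assert (E1 : forall x, P_r q k x y s t v = Pval (Rpower q 2) (Rpower q (2 * k))
    (Rpower q (2 * s + 2)) (Rpower q (2 * t + 2)) z x y).
  { intros x. rewrite P_r_series by exact Hq. apply CSeries_unique.
    apply Pval_series; auto; lra. }
  assert (E2 : forall x, Cconj (P_r q k x y' s t (- Cconj v - RtoC 2)%C)
    = Pval (Rpower q 2) (Rpower q (2 * k))
    (Rpower q (2 * s + 2)) (Rpower q (2 * t + 2)) z' x y').
  { intros x. rewrite P_r_series, CSeries_conj by exact Hq. apply CSeries_unique.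
    assert (S := Pval_series _ _ (Rpower q (2 * s + 2)) (Rpower q (2 * t + 2)) z' x y'
                   Ep Eb (proj1 EA) (proj2 Lz')).
    revert S. apply is_series_C_ext. intros n.
    rewrite Cmult_conj, Cpow_conj, Cconj_Cqpow. f_equal.
    - unfold z'. f_equal. f_equal. destruct v as [a c].
      unfold Cconj, Cminus, Copp, Cplus, RtoC. simpl. f_equal; ring.
    - unfold Cconj, RtoC. simpl. f_equal. ring. }
  apply (is_series_C_ext (fun x => Pval (Rpower q 2) (Rpower q (2 * k))
    (Rpower q (2 * s + 2)) (Rpower q (2 * t + 2)) z x y
    * Pval (Rpower q 2) (Rpower q (2 * k))
    (Rpower q (2 * s + 2)) (Rpower q (2 * t + 2)) z' x y'
    * Wp (Rpower q 2) (Rpower q (2 * k)) (Rpower q (2 * s + 2)) x)%C).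
  { intros x. now rewrite E1, E2, (W_Wp q k s). }
  assert (Hzz : (z * z' = Rpower q (2 * s + 2) * Rpower q (2 * t + 2))%C).
  { unfold z, z'. rewrite <- Cqpow_plus, <- RtoC_mult, <- Rpower_plus, <- Cqpow_RtoC.
    f_equal. replace (2 * s + 2 + (2 * t + 2)) with ((s + t + 1) + (s + t + 3)) by ring.
    rewrite (RtoC_plus (s + t + 1)). ring. }
  (* The radii are the moduli themselves, positive as powers of [q]; the condition on their product
     reads [A B < A]. *)
  apply (P_orthogonality _ _ _ _ (Cmod z) (Cmod z')); auto; try lra.
  rewrite <- Cmod_mult, Hzz, Cmod_mult, !Cmod_pos_real by lra. nra.
Qed.

Lemma P_r_sym (q k s t : R) (v : C) (x y : nat) : 0 < q < 1 ->
  P_r q k x y s t v = P_r q k y x t s v.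
Proof.
  intros Hq. rewrite !P_r_series by exact Hq.
  replace (t + s + 1) with (s + t + 1) by ring.
  unfold CSeries. f_equal; apply Series_ext; intros n; f_equal; f_equal; f_equal; ring.
Qed.

Theorem proposition4p3 :
  forall (q k s t : R) (v : C),
    0 < q < 1 -> 0 < k -> -1 < s -> -1 < t ->
    Rabs (Re v + 1) < 2 + s + t ->
    (forall y y' : nat,
       is_series
         (fun x : nat =>
            (P_r q k x y s t v
             * Cconj (P_r q k x y' s t (- Cconj v - RtoC 2))
             * RtoC (W q k x s))%C)
         (RtoC (delta y y' / W q k y t)))
    /\
    (forall x x' : nat,
       is_series
         (fun y : nat =>
            (P_r q k x y s t v
             * Cconj (P_r q k x' y s t (- Cconj v - RtoC 2))
             * RtoC (W q k y t))%C)
         (RtoC (delta x x' / W q k x s))).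
Proof.
  intros q k s t v Hq Hk Hs Ht Hv. split.
  - intros y y'. now apply P_r_orthogonality.
  - intros x x'.
    apply (is_series_C_ext (fun y => P_r q k y x t s v
       * Cconj (P_r q k y x' t s (- Cconj v - RtoC 2)) * RtoC (W q k y t))%C).
    + intros y. now rewrite (P_r_sym q k t s v), (P_r_sym q k t s (- Cconj v - RtoC 2)%C).
    + apply P_r_orthogonality; auto. replace (2 + t + s) with (2 + s + t) by ring.
      exact Hv.
Qed.
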